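(* The maximum cut problem can be solved in time $O(|V(G^T)|^4)$ on a co-bipartite chain graph $G^T$.
   Context: A co-bipartite chain graph is a graph whose vertex set can be partitioned into two cliques $K,K'$ such that the neighborhoods of the vertices of $K$ can be linearly ordered by inclusion. A cut of a graph $G$ is a subset $S\subseteq V(G)$; its size is the number of edges with exactly one endpoint in $S$. The maximum cut problem is to find a cut of maximum size (equivalently, its size) of a given graph. *)

(* Defs.v *)
From mathcomp Require Import all_boot.

Set Implicit Arguments.
Unset Strict Implicit.
Unset Printing Implicit Defensive.

(* A simple graph on T is a symmetric irreflexive e : rel T. *)

Definition edges (T : finType) (e : rel T) : {set {set T}} :=
  [set f : {set T} | [exists x, exists y, e x y && (f == [set x; y])]].

Definition cut_size (T : finType) (e : rel T) (S : {set T}) : nat :=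
  #|[set f in edges e | #|f :&: S| == 1]|.

Definition maximum_cut (T : finType) (e : rel T) (S : {set T}) : Prop :=
  forall S' : {set T}, cut_size e S' <= cut_size e S.

Definition clique (T : finType) (e : rel T) (K : {set T}) : Prop :=
  {in K &, forall x y, x != y -> e x y}.

Definition nbhd (T : finType) (e : rel T) (x : T) : {set T} := [set y | e x y].

(* The open neighborhoods of two distinct vertices of a clique are never
   comparable, so the inclusions are between neighborhoods in K' (equivalently,
   between closed neighborhoods). Either clique may be empty. *)
Definition cobipartite_chain (T : finType) (e : rel T) : Prop :=
  exists K K' : {set T},
    [/\ K :|: K' = [set: T], [disjoint K & K'], clique e K, clique e K'
      & {in K &, forall x y,
           (nbhd e x :&: K' \subset nbhd e y :&: K') \/
           (nbhd e y :&: K' \subset nbhd e x :&: K')}].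

(* Computation model: while-programs on a word RAM. A machine has registers
   and an addressable memory, both holding w-bit words; arithmetic is modulo
   2 ^ w, except that subtraction is truncated at 0. Every operator, literal,
   register access, memory access, assignment and branching test costs one
   unit of time. *)

Inductive binop := Add | Sub | Mul | Ltn | Eqn.

Inductive expr :=
  | Lit of nat
  | Reg of nat
  | Read of expr
  | Bin of binop & expr & expr.

Inductive prog :=
  | Skip
  | Assign of nat & expr
  | Write of expr & expr
  | Seq of prog & prog
  | If of expr & prog & prog
  | While of expr & prog.

Record state := State { regs : nat -> nat; mem : nat -> nat }.

Definition update (f : nat -> nat) (i v : nat) : nat -> nat :=
  fun j => if j == i then v else f j.

Definition binop_sem (o : binop) (a b : nat) : nat :=
  match o with
  | Add => a + b
  | Sub => a - b
  | Mul => a * b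
  | Ltn => a < b
  | Eqn => (a == b)
  end.

Fixpoint eval (w : nat) (s : state) (x : expr) : nat :=
  match x with
  | Lit k => k %% 2 ^ w
  | Reg r => regs s r
  | Read a => mem s (eval w s a)
  | Bin o x1 x2 => binop_sem o (eval w s x1) (eval w s x2) %% 2 ^ w
  end.

Fixpoint cost (x : expr) : nat :=
  match x with
  | Lit _ | Reg _ => 1
  | Read a => (cost a).+1
  | Bin _ x1 x2 => (cost x1 + cost x2).+1
  end.

(* exec w p s t s' : on w-bit words, p started in s halts in s' after time t. *)
Inductive exec (w : nat) : prog -> state -> nat -> state -> Prop :=
  | ExecSkip s : exec w Skip s 1 s
  | ExecAssign r x s :
      exec w (Assign r x) s (cost x).+1
        (State (update (regs s) r (eval w s x)) (mem s))
  | ExecWrite a x s :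
      exec w (Write a x) s (cost a + cost x).+1
        (State (regs s) (update (mem s) (eval w s a) (eval w s x)))
  | ExecSeq p q s1 s2 s3 t1 t2 :
      exec w p s1 t1 s2 -> exec w q s2 t2 s3 ->
      exec w (Seq p q) s1 (t1 + t2) s3
  | ExecIfTrue x p q s s' t :
      eval w s x != 0 -> exec w p s t s' ->
      exec w (If x p q) s ((cost x).+1 + t) s'
  | ExecIfFalse x p q s s' t :
      eval w s x = 0 -> exec w q s t s' ->
      exec w (If x p q) s ((cost x).+1 + t) s'
  | ExecWhileTrue x p s1 s2 s3 t1 t2 :
      eval w s1 x != 0 -> exec w p s1 t1 s2 -> exec w (While x p) s2 t2 s3 ->
      exec w (While x p) s1 ((cost x).+1 + t1 + t2) s3
  | ExecWhileFalse x p s :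
      eval w s x = 0 -> exec w (While x p) s (cost x).+1 s.

(* c times the bit length of n: words have O(log n) bits. *)
Definition word_bits (c n : nat) : nat := c * (trunc_log 2 n).+1.

(* Register 0 holds n; the memory holds the adjacency matrix, row by row from
   address 0; everything else is 0. *)
Definition input (n : nat) (e : rel 'I_n) : state :=
  State (fun r => if r == 0 then n else 0)
        (fun a => [exists i : 'I_n, exists j : 'I_n,
                     e i j && (a == i * n + j)] : nat).

(* The indicator of S is at addresses 0, ..., n - 1, and the size of the cut S
   is in register 0. *)
Definition outputs_cut (n : nat) (e : rel 'I_n) (s : state) (S : {set 'I_n}) :
    Prop :=
  (forall i : 'I_n, mem s i = (i \in S)) /\ regs s 0 = cut_size e S.

Definition bigO (f g : nat -> nat) : Prop :=
  exists c n0 : nat, forall n : nat, n0 <= n -> f n <= c * g n.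

Definition solves_maxcut_in_time
    (C : forall n : nat, rel 'I_n -> Prop) (p : prog) (T : nat -> nat) : Prop :=
  exists2 c : nat, 0 < c &
  forall (n : nat) (e : rel 'I_n), symmetric e -> irreflexive e -> C n e ->
  exists (t : nat) (s : state) (S : {set 'I_n}),
    [/\ exec (word_bits c n) p (input e) t s, t <= T n,
        outputs_cut e s S & maximum_cut e S].

(* Main.v *)
Require Import Defs.
From mathcomp Require Import all_boot zify.
(* Imported again so that mem denotes the memory of a state. *)
Import Defs.

Set Implicit Arguments.
Unset Strict Implicit.
Unset Printing Implicit Defensive.

(** Let u have minimum degree, let K' be the set of vertices other than u that
    are not adjacent to u, and let K be the rest. Then K and K' are cliques, and
    since the graph has no induced 4-cycle they still form a chain. Hence the
    vertices can be listed in such a way that every vertex of K is adjacent to all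
    its predecessors, and every vertex of K' exactly to its predecessors in K'.
    The number of cut edges from the i-th vertex back to its predecessors then
    depends only on i, on the number p of predecessors in K', on the number t of
    predecessors in S and on the number c of predecessors in S and K'. Dynamic
    programming over (i, t, c), with p a function of i, gives the maximum, and a
    forward pass through the table recovers S. All of this takes time O(n^3). *)

(** The machine receives only the adjacency matrix, so a partition into cliques has to be computed;
    minimum degree serves this purpose. The partition obtained from [u] may differ from the given
    one, hence its chain condition needs a proof of its own. The condition used throughout is the
    absence of two edges between the cliques without a crossing edge, which treats both cliques
    alike. The order of the vertices is built greedily. The graph theory only has to show that some
    unlisted vertex has the right adjacencies to all the others; the program finds one by testing
    all candidates. Words have O(log n) bits and arithmetic is modular, so every intermediate value
    needs a bound. The largest numbers are addresses in the table, which are cubic in n. *)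

(** * Time-bounded weakest preconditions *)

(* Evaluation without overflow; fits B s x says that none occurs below B. *)
Fixpoint evN (s : state) (x : expr) : nat :=
  match x with
  | Lit k => k
  | Reg r => regs s r
  | Read a => mem s (evN s a)
  | Bin o x1 x2 => binop_sem o (evN s x1) (evN s x2)
  end.

Fixpoint fits (B : nat) (s : state) (x : expr) : Prop :=
  match x with
  | Lit k => k < B
  | Reg _ => True
  | Read a => fits B s a
  | Bin o x1 x2 =>
      [/\ fits B s x1, fits B s x2 & binop_sem o (evN s x1) (evN s x2) < B]
  end.

Lemma evalE w s x : fits (2 ^ w) s x -> eval w s x = evN s x.
Proof.
elim: x => //= [k hk|a IH ha|o x1 IH1 x2 IH2 [h1 h2 h]]; first exact: modn_small.
  by rewrite IH.
by rewrite IH1 // IH2 // modn_small.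
Qed.

Fixpoint assigned (p : prog) : seq nat :=
  match p with
  | Assign r _ => [:: r]
  | Seq p q | If _ p q => assigned p ++ assigned q
  | While _ p => assigned p
  | _ => [::]
  end.

Fixpoint writes (p : prog) : bool :=
  match p with
  | Write _ _ => true
  | Seq p q | If _ p q => writes p || writes q
  | While _ p => writes p
  | _ => false
  end.

(** Memory is treated as a whole: once [b] holds, nothing is claimed about it, and the loop
    invariants have to describe it. *)
Definition frame (rs : seq nat) (b : bool) (s s' : state) : Prop :=
  (forall r, r \notin rs -> regs s' r = regs s r) /\ (b \/ mem s' = mem s).

Lemma frame_refl rs b s : frame rs b s s.
Proof. by split=> //; right. Qed.

Lemma frame_trans rs b s1 s2 s3 :
  frame rs b s1 s2 -> frame rs b s2 s3 -> frame rs b s1 s3.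
Proof.
move=> [r12 m12] [r23 m23]; split=> [r rP|]; first by rewrite r23 ?r12.
case: m12 => [bT|m12]; first by left.
by case: m23 => [bT|m23]; [left|right; rewrite m23].
Qed.

Lemma frame_sub rs rs' (b b' : bool) s s' :
  {subset rs <= rs'} -> (b -> b') -> frame rs b s s' -> frame rs' b' s s'.
Proof.
move=> sub bb [fr fm]; split=> [r rP|]; first by apply: fr; apply: contra rP => /sub.
by case: fm => [/bb|->]; [left|right].
Qed.

Lemma exec_frame w p s t s' :
  exec w p s t s' -> frame (assigned p) (writes p) s s'.
Proof.
have subl (T : eqType) (r1 r2 : seq T) : {subset r1 <= r1 ++ r2}.
  by move=> x xP; rewrite mem_cat xP.
have subr (T : eqType) (r1 r2 : seq T) : {subset r2 <= r1 ++ r2}.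
  by move=> x xP; rewrite mem_cat xP orbT.
elim=> {p s t s'} /=.
- by move=> s; exact: frame_refl.
- move=> r x s; split=> /= [j|]; last by right.
  by rewrite inE /update => /negbTE->.
- by move=> a x s; split=> //=; left.
- move=> p q s1 s2 s3 t1 t2 _ f1 _ f2.
  apply: frame_trans (frame_sub _ _ f1) (frame_sub _ _ f2) => // -> //.
  by rewrite orbT.
- by move=> x p q s s' t _ _; apply: frame_sub => // ->.
- by move=> x p q s s' t _ _; apply: frame_sub => // ->; rewrite orbT.
- by move=> x p s1 s2 s3 t1 t2 _ _ f1 _ f2; exact: frame_trans f1 f2.
- by move=> x p s _; exact: frame_refl.
Qed.

(** Total correctness with a time budget. The budget is only an upper bound, so the constants can be
    rounded up at every rule. *)
Definition wp (w : nat) (p : prog) (Q : state -> Prop) (s : state) (t : nat) : Prop :=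
  exists t' s', [/\ exec w p s t' s', t' <= t & Q s'].

Definition setr (s : state) (r v : nat) : state :=
  State (update (regs s) r v) (mem s).

Definition setm (s : state) (a v : nat) : state :=
  State (regs s) (update (mem s) a v).

Section Rules.
Context (w : nat).

(** The frame is read off the program text, so that specifications need not mention the registers
    that a program leaves alone. *)
Lemma wp_frame p Q s t :
  wp w p Q s t ->
  wp w p (fun s' => frame (assigned p) (writes p) s s' /\ Q s') s t.
Proof.
by move=> [t' [s' [ex le q]]]; exists t', s'; split=> //; split=> //; exact: exec_frame ex.
Qed.

Lemma wp_mono p (Q Q' : state -> Prop) s t t' :
  wp w p Q s t -> t <= t' -> (forall s', Q s' -> Q' s') -> wp w p Q' s t'.
Proof.
move=> [t1 [s1 [ex le q]]] tt' QQ'; exists t1, s1.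
by split=> //; [exact: leq_trans tt'|exact: QQ'].
Qed.

Lemma wp_skip (Q : state -> Prop) s t : Q s -> 0 < t -> wp w Skip Q s t.
Proof. by move=> q le; exists 1, s; split=> //; exact: ExecSkip. Qed.

Lemma wp_assign r x (Q : state -> Prop) s t :
  fits (2 ^ w) s x -> Q (setr s r (evN s x)) -> cost x < t ->
  wp w (Assign r x) Q s t.
Proof.
move=> fx q le; exists (cost x).+1, (setr s r (eval w s x)).
by split=> //; [exact: ExecAssign|rewrite evalE].
Qed.

Lemma wp_write a x (Q : state -> Prop) s t :
  fits (2 ^ w) s a -> fits (2 ^ w) s x -> Q (setm s (evN s a) (evN s x)) ->
  cost a + cost x < t -> wp w (Write a x) Q s t.
Proof.
move=> fa fx q le; exists (cost a + cost x).+1, (setm s (eval w s a) (eval w s x)).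
by split=> //; [exact: ExecWrite|rewrite !evalE].
Qed.

Lemma wp_seq t1 t2 p q (Q : state -> Prop) s t :
  wp w p (fun s' => wp w q Q s' t2) s t1 -> t1 + t2 <= t ->
  wp w (Seq p q) Q s t.
Proof.
move=> [u1 [s1 [ex1 le1 [u2 [s2 [ex2 le2 Q2]]]]]] le.
exists (u1 + u2), s2; split=> //; first exact: ExecSeq ex1 ex2.
by apply: leq_trans le; exact: leq_add.
Qed.

Lemma wp_if t1 x p q (Q : state -> Prop) s t :
  fits (2 ^ w) s x -> (evN s x != 0 -> wp w p Q s t1) ->
  (evN s x = 0 -> wp w q Q s t1) -> cost x + t1 < t ->
  wp w (If x p q) Q s t.
Proof.
move=> fx hp hq le; case: (eqVneq (evN s x) 0) => [x0|x0].
  have [u [s1 [ex le1 q1]]] := hq x0.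
  exists ((cost x).+1 + u), s1; split=> //; last lia.
  by apply: ExecIfFalse ex; rewrite evalE.
have [u [s1 [ex le1 q1]]] := hp x0.
exists ((cost x).+1 + u), s1; split=> //; last lia.
by apply: ExecIfTrue ex; rewrite evalE.
Qed.

Definition For (r : nat) (x : expr) (p : prog) : prog :=
  Seq (Assign r (Lit 0))
    (While (Bin Ltn (Reg r) x) (Seq p (Assign r (Bin Add (Reg r) (Lit 1))))).

(** The bound [x] is evaluated anew at each test, so it must keep the value [N] under all changes
    that the loop can make. A round costs the body, [cost x + 3] for the test and 4 for the
    increment; the last test and the initial assignment account for the final [cost x + 5]. *)
Lemma wp_for (I : nat -> state -> Prop) N tb r x p (Q : state -> Prop) s t :
  N < 2 ^ w -> 1 < 2 ^ w -> r \notin assigned p ->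
  I 0 (setr s r 0) ->
  (forall s', frame (r :: assigned p) (writes p) s s' ->
     fits (2 ^ w) s' x /\ evN s' x = N) ->
  (forall i s1, i < N -> frame (r :: assigned p) (writes p) s s1 ->
     regs s1 r = i -> I i s1 ->
     wp w p (fun s2 => I i.+1 (setr s2 r i.+1)) s1 tb) ->
  (forall s', frame (r :: assigned p) (writes p) s s' -> I N s' -> Q s') ->
  N * (tb + cost x + 7) + cost x + 5 <= t ->
  wp w (For r x p) Q s t.
Proof.
move=> NB B1 rp I0 bound body post le.
pose rs := r :: assigned p.
have loop : forall d i s1, i + d = N -> frame rs (writes p) s s1 -> regs s1 r = i ->
    I i s1 ->
    wp w (While (Bin Ltn (Reg r) x) (Seq p (Assign r (Bin Add (Reg r) (Lit 1)))))
      Q s1 (d * (tb + cost x + 7) + cost x + 3).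
  elim=> [|d IH] i s1 iN fr ri Ii.
    have [fx xN] := bound _ fr.
    have tst : eval w s1 (Bin Ltn (Reg r) x) = 0.
      by rewrite evalE /= ?xN ?ri; [|split=> //]; lia.
    exists (cost (Bin Ltn (Reg r) x)).+1, s1; split; [exact: ExecWhileFalse|by rewrite /=; lia|].
    by apply: post => //; rewrite -iN addn0.
  have [fx xN] := bound _ fr.
  have tst : eval w s1 (Bin Ltn (Reg r) x) != 0.
    by rewrite evalE /= ?xN ?ri; [|split=> //]; lia.
  have iltN : i < N by lia.
  have [t2 [s2 [ex2 le2 [fr2 I2]]]] := wp_frame (body i s1 iltN fr ri Ii).
  pose s3 := setr s2 r i.+1.
  have r2 : regs s2 r = i by rewrite -ri; apply: (proj1 fr2).
  have fr3 : frame rs (writes p) s s3.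
    apply: (frame_trans fr); apply: (@frame_trans _ _ _ s2).
      by apply: frame_sub fr2 => // j jP; rewrite inE jP orbT.
    split=> /= [j|]; last by right.
    by rewrite inE negb_or /update => /andP[/negbTE->].
  have r3 : regs s3 r = i.+1 by rewrite /= /update eqxx.
  have iN3 : i.+1 + d = N by lia.
  have [t4 [s4 [ex4 le4 q4]]] := IH i.+1 s3 iN3 fr3 r3 I2.
  have ex3 : exec w (Assign r (Bin Add (Reg r) (Lit 1))) s2 4 s3.
    have -> : s3 = setr s2 r (eval w s2 (Bin Add (Reg r) (Lit 1))).
      by rewrite evalE /= r2 ?addn1 //; split=> //; lia.
    exact: (ExecAssign w r (Bin Add (Reg r) (Lit 1))).
  exists ((cost (Bin Ltn (Reg r) x)).+1 + (t2 + 4) + t4), s4; split=> //.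
    by apply: ExecWhileTrue ex4 => //; exact: ExecSeq ex2 ex3.
  by rewrite /=; lia.
apply: (@wp_seq 2 (N * (tb + cost x + 7) + cost x + 3)); last lia.
apply: wp_assign => //=; first lia.
apply: (loop N 0) => //=; last by rewrite /update eqxx.
split=> /= [j|]; last by right.
by rewrite inE negb_or /update => /andP[/negbTE->].
Qed.

End Rules.

(** * Co-bipartite chain graphs *)

Definition far (T : eqType) (e : rel T) (u v : T) : bool := ~~ e u v && (u != v).

Section Chain.
Context (T : finType) (e : rel T) (e_sym : symmetric e).

(** The linear order of the neighborhoods, restated without sets. In this form it is symmetric in
    [A] and [B], so [u] may later be assumed to lie in [A]. *)
Definition chain_between (A B : {pred T}) : Prop :=
  forall x x' y y', x \in A -> x' \in A -> y \in B -> y' \in B ->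
    e x y -> e x' y' -> e x y' \/ e x' y.

Definition bicliques (A B : {pred T}) : Prop :=
  [/\ forall x, (x \in B) = (x \notin A), {in A &, forall x y, x != y -> e x y},
      {in B &, forall x y, x != y -> e x y} & chain_between A B].

Lemma bicliquesC A B : bicliques A B -> bicliques B A.
Proof.
move=> [part cA cB ch]; split=> // [x|x x' y y' xB x'B yA y'A]; first by rewrite part negbK.
rewrite ![e _ y]e_sym ![e _ y']e_sym => exy exy'.
by have [|] := ch _ _ _ _ yA y'A xB x'B exy exy'; [right|left].
Qed.

Lemma cobipartite_chain_bicliques :
  cobipartite_chain e -> exists A B : {pred T}, bicliques A B.
Proof.
move=> [K [K' [cov dis cK cK' ch]]]; exists (fun x => x \in K), (fun x => x \in K').
have part x : (x \in K') = (x \notin K).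
  apply/idP/idP => [xK'|xK]; first by rewrite (disjointFl dis xK').
  by move: (in_setT x); rewrite -cov inE (negbTE xK).
split=> // x x' y y' xK x'K yK' y'K' exy exy'.
have [/subsetP sub|/subsetP sub] := ch x x' xK x'K.
  by right; have := sub y; rewrite !inE exy (yK' : y \in K') !andbT; apply.
by left; have := sub y'; rewrite !inE exy' (y'K' : y' \in K') !andbT; apply.
Qed.

(* Otherwise x, x', y', y would induce a 4-cycle. *)
Lemma bicliques_chain A B (P : {pred T}) : bicliques A B ->
  {in [predC P] &, forall x y, x != y -> e x y} ->
  {in P &, forall x y, x != y -> e x y} -> chain_between [predC P] P.
Proof.
move=> bic cP' cP x x' y y' xP x'P yP y'P exy ex'y'.
case exy': (e x y'); first by left.
case ex'y: (e x' y); first by right.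
have [part cA cB ch] := bic; have [_ _ _ chB] := bicliquesC bic.
have neq a b : a \in [predC P] -> b \in P -> a != b.
  by move=> aP bP; apply: contraL bP => /eqP <-.
(* Non-adjacent vertices lie on different sides, so both diagonals of the 4-cycle join [A] to [B].
   Then two opposite edges of the cycle also join [A] to [B], and the diagonals are their missing
   crossing edges. *)
have sep a b : e a b = false -> a != b -> (a \in A) = (b \notin A).
  move=> eab ab; case aA: (a \in A); case bA: (b \in A) => //.
    by rewrite cA in eab.
  by rewrite cB ?part ?aA ?bA in eab.
have s1 := sep _ _ exy' (neq _ _ xP y'P).
have s2 := sep _ _ ex'y (neq _ _ x'P yP).
have xx' : x != x' by apply/eqP => xx'; rewrite xx' ex'y in exy.
have yy' : y != y' by apply/eqP => yy'; rewrite yy' exy' in exy.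
have exx' := cP' _ _ xP x'P xx'.
have eyy' := cP _ _ yP y'P yy'.
case xA: (x \in A); case x'A: (x' \in A).
- have := @ch x x' y y' xA x'A; rewrite !part exy' ex'y.
  by move: s1 s2; rewrite xA x'A => <- <- /(_ isT isT exy ex'y') [].
- have := @ch x y x' y' xA; rewrite !part x'A exy' [e y x']e_sym ex'y.
  by move: s1 s2; rewrite xA x'A => <- /esym/negbFE -> /(_ isT isT isT exx' eyy') [].
- have := @chB x y x' y'; rewrite !part xA x'A exy' [e y x']e_sym ex'y /=.
  by move: s1 s2; rewrite xA x'A => /esym/negbFE -> <- /(_ isT isT isT isT exx' eyy') [].
have := @chB x x' y y'; rewrite !part xA x'A exy' ex'y.
by move: s1 s2; rewrite xA x'A => /esym/negbFE -> /esym/negbFE -> /(_ isT isT isT isT exy ex'y') [].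
Qed.

(** Vertices far from [u] lie in [B]. If a neighbor [w] of [u] in [B] were not adjacent to some [x]
    in [A], the chain condition would put the neighbors of [x] in [B] strictly inside those of [u],
    and [x] would have smaller degree than [u]. *)
Lemma far_bicliques_in A B u : irreflexive e -> bicliques A B -> u \in A ->
  (forall v, #|nbhd e u| <= #|nbhd e v|) ->
  {in [predC far e u] &, forall x y, x != y -> e x y} /\
  {in far e u &, forall x y, x != y -> e x y}.
Proof.
move=> eirr [part cA cB ch] uA umin.
have farB w : w \in far e u -> w \in B.
  rewrite part /far => /andP[nuw uw]; apply: contra nuw => wA; exact: cA.
have nearE w : w \in B -> w \in [predC far e u] -> e u w.
  rewrite part !inE /far negb_and !negbK => wB /orP[//|/eqP uw].
  by rewrite -uw uA in wB.
have full w x : w \in B -> e u w -> x \in A -> e x w.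
  move=> wB euw xA; apply: contraT => nxw.
  have xu : x != u by apply: contraNneq nxw => ->.
  suff: #|nbhd e x| < #|nbhd e u| by rewrite ltnNge umin.
  (* Closed neighborhoods are compared because [x] and [u] are adjacent, which makes their open
     neighborhoods incomparable. *)
  have sub : x |: nbhd e x \proper u |: nbhd e u.
    apply/properP; split; last first.
      exists w; rewrite !inE ?euw ?orbT // (negbTE nxw) orbF.
      by apply: contraTneq wB => ->; rewrite part xA.
    apply/subsetP => y; rewrite !inE => /predU1P[->|exy].
      by rewrite cA ?orbT // eq_sym.
    case yA: (y \in A).
      by case: eqVneq => //= yu; apply: cA; rewrite // eq_sym.
    have yB : y \in B by rewrite part yA.
    have [->|] := ch u x w y uA xA wB yB euw exy; first by rewrite orbT.
    by rewrite (negbTE nxw).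
  by have := proper_card sub; rewrite !cardsU1 !inE !eirr.
split=> x y xF yF xy; last by apply: cB => //; exact: farB.
case xA: (x \in A); case yA: (y \in A).
- exact: cA.
- by apply: full => //; [rewrite part yA|apply: nearE; rewrite ?part ?yA].
- by rewrite e_sym; apply: full => //; [rewrite part xA|apply: nearE; rewrite ?part ?xA].
- by apply: cB => //; rewrite part ?xA ?yA.
Qed.

Lemma far_bicliques u : irreflexive e -> cobipartite_chain e ->
  (forall v, #|nbhd e u| <= #|nbhd e v|) -> bicliques [predC far e u] (far e u).
Proof.
move=> eirr /cobipartite_chain_bicliques [A [B bic]] umin.
have [c1 c2] : {in [predC far e u] &, forall x y, x != y -> e x y} /\
  {in far e u &, forall x y, x != y -> e x y}.
  case uA: (u \in A); first exact: (far_bicliques_in eirr bic).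
  have [part _ _ _] := bic.
  by apply: (far_bicliques_in eirr (bicliquesC bic)); rewrite ?part ?uA.
by split=> // [x|]; [rewrite inE /= negbK|exact: bicliques_chain bic c1 c2].
Qed.

(** Let [x] in [A] have the fewest neighbors among the vertices of [B] in [R]. If it has such a
    neighbor [y], then the chain condition makes [y] adjacent to all the rest of [R], and [y] is
    chosen; otherwise [x] is. If [R] misses [A], any vertex will do. *)
Lemma bicliques_next A B (R : {set T}) : bicliques A B -> R != set0 ->
  exists2 v, v \in R &
    {in R, forall w, w != v -> e v w = ((w \in B) <= (v \in B))}.
Proof.
move=> [part cA cB ch] /set0Pn[r rR].
case: (pickP [pred x | (x \in R) && (x \in A)]) => [x0 x0P|noA]; last first.
  have inB z : z \in R -> z \in B by move=> zR; have := noA z; rewrite /= zR part /= => ->.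
  by exists r => // w wR wr; rewrite cB ?inB // eq_sym.
have [x /andP[xR xA] xmin] := @arg_minnP _ x0 [pred x | (x \in R) && (x \in A)]
  (fun x => #|nbhd e x :&: (R :&: [set y in B])|) x0P.
case: (pickP [pred y | [&& y \in R, y \in B & e x y]]) => [y /and3P[yR yB exy]|noy].
  exists y => // w wR wy; rewrite yB leq_b1.
  case wB: (w \in B); first by rewrite cB // eq_sym.
  have wA : w \in A by rewrite -[_ \in A]negbK -part wB.
  rewrite e_sym; apply: contraT => nwy.
  (* By the minimality of [x], an inclusion would be an equality, but [y] belongs only to the second
     set. *)
  have /subsetPn[y'] : ~~ (nbhd e w :&: (R :&: [set y in B]) \subset
                         nbhd e x :&: (R :&: [set y in B])).
    have wmin := xmin w; rewrite /= wR wA /= in wmin; have {}wmin := wmin isT.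
    apply/negP => sub; have := subset_leqif_cards sub.
    move=> [le /esym eq]; rewrite eqn_leq le wmin in eq.
    move/eqP/setP/(_ y): eq; rewrite !inE yR yB exy (negbTE nwy).
    by [].
  rewrite !inE => /and3P[ewy' y'R y'B]; rewrite y'R y'B !andbT => nxy'.
  have [] := ch x w y y' xA wA yB y'B exy ewy'.
    by rewrite (negbTE nxy').
  by rewrite (negbTE nwy).
exists x => // w wR wx; rewrite part xA.
case wA: (w \in A); first by rewrite part wA cA // eq_sym.
by have := noy w; rewrite /= wR part wA /= => ->.
Qed.
End Chain.

(** * Cuts along a vertex list *)

(** The predecessors adjacent to the vertex and outside [S]: there are [p - c] of them if it lies in
    K' and [i - t] if it lies in K. The label is a factor so that the program can compute the gain
    by an expression without branching. *)
Definition gain_in (l i p t c : nat) : nat := l * (p - c) + (1 - l) * (i - t).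
Definition gain_out (l t c : nat) : nat := l * c + (1 - l) * t.

Fixpoint best_gain (ls : seq bool) (i p t c : nat) : nat :=
  if ls is l :: ls' then
    maxn (gain_in l i p t c + best_gain ls' i.+1 (p + l) t.+1 (c + l))
         (gain_out l t c + best_gain ls' i.+1 (p + l) t c)
  else 0.

(** Needed against overflow. It also covers triples that no set [S] realizes, such as [c > t], since
    the table has entries for them. *)
Lemma best_gain_bound N ls i p t c :
  i + size ls <= N -> p <= i -> t <= i -> c <= i ->
  best_gain ls i p t c <= size ls * N.
Proof.
elim: ls i p t c => //= l ls IH i p t c iN pi ti ci.
have h1 := IH i.+1 (p + l) t.+1 (c + l).
have h0 := IH i.+1 (p + l) t c.
rewrite geq_max mulSn /gain_in /gain_out; case: l h1 h0 => h1 h0; lia.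
Qed.

(** Only pairs directed out of [S] contribute, so on a list without repetition each cut edge is
    counted once. *)
Definition list_cut (E : rel nat) (S : pred nat) (vs : seq nat) : nat :=
  \sum_(u <- vs) \sum_(v <- vs) [&& E u v, S u & ~~ S v].

Definition precedes (E : rel nat) (L : pred nat) : rel nat :=
  fun v w => E v w == (L w <= L v).

Section ListCut.
Context (E : rel nat) (L : pred nat) (E_sym : symmetric E).

Definition step_gain (b : bool) (l i p t c : nat) : nat :=
  if b then gain_in l i p t c else gain_out l t c.

(** By symmetry of [E], the new pairs in the two directions merge into one sum over the
    predecessors. There [precedes] replaces adjacency to [v] by a comparison of labels, which leaves
    only counts. *)
Lemma list_cut_rcons S vs v : all (precedes E L ^~ v) vs ->
  list_cut E S (rcons vs v) =
  list_cut E S vs + step_gain (S v) (L v) (size vs) (count L vs) (count S vs)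
                      (count (predI S L) vs).
Proof.
move=> /allP ord; rewrite /list_cut -cats1 big_cat big_seq1 /=.
under eq_bigr => u _ do rewrite big_cat big_seq1 /=.
rewrite big_split /= -addnA; congr (_ + _).
rewrite big_cat big_seq1 /= andbN andbF addn0.
have -> : \sum_(j <- vs) [&& E v j, S v & ~~ S j] =
          \sum_(j <- vs) [&& E j v, S v & ~~ S j].
  by apply: eq_bigr => j _; rewrite E_sym.
rewrite -big_split /=.
have -> : \sum_(u <- vs) ([&& E u v, S u & ~~ S v] + [&& E u v, S v & ~~ S u]) =
  \sum_(u <- vs) ((L v <= L u) && (S u != S v)).
  rewrite big_seq [RHS]big_seq; apply: eq_bigr => u /ord /eqP ->.
  by case: (S u); case: (S v); case: (_ <= _).
have cnt (P : pred nat) : \sum_(u <- vs) P u = count P vs by rewrite -sumn_count sumnE big_map.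
rewrite cnt /step_gain /gain_in /gain_out.
(* These identities turn the differences in [gain_in] into counts of predecessors outside [S]. *)
have tot := count_predC S vs.
have totL := count_predC S (filter L vs).
rewrite size_filter !count_filter in totL.
case: (S v); case: (L v) => /=.
- rewrite mul1n mul0n addn0 -totL addKn.
  by apply: eq_count => u /=; case: (L u); case: (S u).
- rewrite mul0n mul1n add0n -tot addKn.
  by apply: eq_count => u /=; case: (L u); case: (S u).
- rewrite mul1n mul0n addn0; apply: eq_count => u /=.
  by case: (L u); case: (S u).
- rewrite mul0n mul1n add0n; apply: eq_count => u /=.
  by case: (L u); case: (S u).
Qed.

(** At each vertex, membership in [S] selects one of the two branches of the maximum in
    [best_gain]. *)
Lemma list_cut_le S vs1 vs2 : pairwise (precedes E L) (vs1 ++ vs2) ->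
  list_cut E S (vs1 ++ vs2) <=
  list_cut E S vs1 + best_gain (map L vs2) (size vs1) (count L vs1) (count S vs1)
                       (count (predI S L) vs1).
Proof.
elim: vs2 vs1 => [|v vs2 IH] vs1; first by rewrite cats0 leq_addr.
rewrite -cat_rcons => pw; apply: leq_trans (IH _ pw) _.
move: pw; rewrite pairwise_cat pairwise_rcons => /and3P[_ /andP[al _] _].
rewrite list_cut_rcons // -addnA leq_add2l /=.
rewrite -!cats1 !count_cat size_cat /= !addn0 addn1 /step_gain.
case: (S v) => /=; last by rewrite !addn0 leq_maxr.
by rewrite addn1 leq_maxl.
Qed.

End ListCut.

Lemma perm_list_cut E S vs ws : perm_eq vs ws -> list_cut E S vs = list_cut E S ws.
Proof.
move=> pe; rewrite /list_cut (perm_big _ pe); apply: eq_bigr => u _.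
exact: perm_big.
Qed.

Lemma eq_list_cut E S S' vs : {in vs, S =1 S'} -> list_cut E S vs = list_cut E S' vs.
Proof.
move=> SS; rewrite /list_cut big_seq [RHS]big_seq; apply: eq_bigr => u uP.
by rewrite big_seq [RHS]big_seq; apply: eq_bigr => v vP; rewrite !SS.
Qed.

(** * From sets of ordinals to lists of numbers *)

Definition nat_rel (n : nat) (e : rel 'I_n) : rel nat :=
  fun v w => [exists i : 'I_n, exists j : 'I_n, [&& e i j, v == i & w == j]].

Section NatRel.
Context (n : nat) (e : rel 'I_n).

Lemma nat_relE (i j : 'I_n) : nat_rel e i j = e i j.
Proof.
apply/existsP/idP => [[i' /existsP[j' /and3P[eij /eqP/val_inj-> /eqP/val_inj->]]] //|eij].
by exists i; apply/existsP; exists j; rewrite eij !eqxx.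
Qed.

Lemma nat_rel_sym : symmetric e -> symmetric (nat_rel e).
Proof.
move=> es v w; apply/existsP/existsP => [] [i /existsP[j /and3P[eij vi wj]]];
  by exists j; apply/existsP; exists i; rewrite es eij wj.
Qed.

Lemma cut_size_list_cut (S : {set 'I_n}) (P : pred nat) :
  symmetric e -> irreflexive e -> (forall i : 'I_n, P i = (i \in S)) ->
  cut_size e S = list_cut (nat_rel e) P (iota 0 n).
Proof.
move=> es ei PS.
have pair_set (x y : 'I_n) : x \in S -> y \notin S -> [set x; y] :&: S = [set x].
  move=> xS yS; apply/setP => z; rewrite !inE.
  case: (eqVneq z x) => [->|zx] /=; first by rewrite xS.
  by case: eqVneq => [->|] //=; rewrite (negbTE yS).
rewrite /cut_size.
(* Each cut edge is listed from its end in [S]. By [pair_set] that end can be recovered from the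
   edge, which gives injectivity. *)
pose D := [set p : 'I_n * 'I_n | [&& e p.1 p.2, p.1 \in S & p.2 \notin S]].
have -> : [set f in edges e | #|f :&: S| == 1] = [set [set p.1; p.2] | p in D].
  apply/setP => f; rewrite !inE; apply/andP/imsetP => [[]|[[x y]]]; last first.
    rewrite inE /= => /and3P[exy xS yS] ->; split; last by rewrite pair_set // cards1.
    by apply/existsP; exists x; apply/existsP; exists y; rewrite exy eqxx.
  case/existsP=> x /existsP[y /andP[exy /eqP->]].
  have xy : x != y by apply: contraTneq exy => ->; rewrite ei.
  case xS: (x \in S); case yS: (y \in S).
  - have -> : [set x; y] :&: S = [set x; y].
      by apply/setIidPl/subsetP => z; rewrite !inE => /orP[] /eqP->.
    by rewrite cards2 xy.
  - by move=> _; exists (x, y); rewrite // inE exy xS yS.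
  - by move=> _; exists (y, x); [rewrite inE /= es exy xS yS|rewrite /= setUC].
  - have -> : [set x; y] :&: S = set0.
      apply/setP => z; rewrite !inE; case: (eqVneq z x) => [->|_] /=; first by rewrite xS.
      by case: (eqVneq z y) => [->|] //=; rewrite yS.
    by rewrite cards0.
rewrite card_in_imset; last first.
  move=> [x y] [x' y'] /=; rewrite !inE /= => /and3P[exy xS yS] /and3P[exy' xS' yS'] eq.
  have xx : x = x'.
    by apply/set1P; rewrite -(pair_set _ _ xS' yS') -eq !inE eqxx.
  congr pair => //; move/setP/(_ y): eq; rewrite !inE eqxx orbT => /esym.
  by case: eqVneq => [yx|_ /eqP //]; rewrite yx xS' in yS.
have -> : iota 0 n = index_iota 0 n by rewrite /index_iota subn0.
rewrite /list_cut.
rewrite -sum1dep_card big_mkcond /= big_mkord.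
under [RHS]eq_bigr => i _ do rewrite big_mkord.
rewrite pair_bigA /=; apply: eq_bigr => [] [x y] _ /=.
by rewrite nat_relE !PS; case: ifP.
Qed.

End NatRel.

(** * The program *)

(** A number with digits [a], [b], [c] in base [M] below an unrestricted leading digit [k], which
    selects the array. One-dimensional arrays use [a = b = 0]. *)
Definition enc (M k a b c : nat) : nat := ((k * M + a) * M + b) * M + c.

Lemma mulnD_inj M a b c d : b < M -> d < M -> a * M + b = c * M + d -> a = c /\ b = d.
Proof.
move=> bM dM eq; have M0 : 0 < M by case: M bM {dM eq}.
have := congr1 (modn^~ M) eq; have := congr1 (divn^~ M) eq.
by rewrite !divnMDl // !modnMDl !(divn_small bM) !(divn_small dM) !modn_small // !addn0.
Qed.

Lemma enc_inj M k a b c k' a' b' c' :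
  a < M -> b < M -> c < M -> a' < M -> b' < M -> c' < M ->
  enc M k a b c = enc M k' a' b' c' -> [/\ k = k', a = a', b = b' & c = c'].
Proof.
move=> aM bM cM a'M b'M c'M.
by move=> /(mulnD_inj cM c'M)[/(mulnD_inj bM b'M)[/(mulnD_inj aM a'M)[-> ->] ->] ->].
Qed.

Lemma update_enc m M v k a b c k' a' b' c' :
  a < M -> b < M -> c < M -> a' < M -> b' < M -> c' < M ->
  update m (enc M k a b c) v (enc M k' a' b' c') =
  if [&& k' == k, a' == a, b' == b & c' == c] then v else m (enc M k' a' b' c').
Proof.
move=> aM bM cM a'M b'M c'M; rewrite /update.
case: (enc M k' a' b' c' =P _) => [/enc_inj[] // -> -> -> ->|ne]; first by rewrite !eqxx.
by case: and4P => // -[/eqP ek /eqP ea /eqP eb /eqP ec]; case: ne; rewrite ek ea eb ec.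
Qed.

Lemma enc_ge M k a b c : 0 < k -> M * M * M <= enc M k a b c.
Proof. by move=> k0; rewrite /enc; nia. Qed.

Lemma enc_lt M k a b c : a < M -> b < M -> c < M -> enc M k a b c < k.+1 * (M * M * M).
Proof.
move=> aM bM cM; rewrite /enc.
have h1 : k * M + a + 1 <= k.+1 * M by lia.
have h2 : (k * M + a) * M + b + 1 <= k.+1 * M * M by nia.
nia.
Qed.

(* The input lies below address M ^ 2, hence below every array k > 0. Register 1
   holds M; the term is locked against simplification. *)
Definition Enc (k : nat) (a b c : expr) : expr :=
  locked (Bin Add (Bin Mul (Bin Add (Bin Mul (Bin Add (Bin Mul (Lit k) (Reg 1)) a)
    (Reg 1)) b) (Reg 1)) c).
Definition Cell (k : nat) (a : expr) : expr := Enc k (Lit 0) (Lit 0) a.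

Definition Adj (v w : nat) : expr :=
  locked (Read (Bin Add (Bin Mul (Reg v) (Reg 0)) (Reg w))).
Lemma cost_Cell k a : cost (Cell k a) = cost a + 12.
Proof. by rewrite /Cell /Enc -lock /=; lia. Qed.

Lemma cost_Enc k a b c : cost (Enc k a b c) = cost a + cost b + cost c + 10.
Proof. by rewrite /Enc -lock /=; lia. Qed.

Lemma cost_Adj v v' : cost (Adj v v') = 6.
Proof. by rewrite /Adj -lock. Qed.

Definition cost_read := (cost_Cell, cost_Enc, cost_Adj).

Definition LAB := 1.
Definition DONE := 2.
Definition ORD := 3.
Definition PRE := 4.
Definition TAB := 5.

(* Registers: 0 holds n; 1 the base n + 1; 2 the vertex u; 3 the least degree so
   far; 4 and 5 two vertices; 7 a position i in the list, 8 the vertex there, 10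
   its label (1 on K'), 11 the number of vertices of K' before it; 9 the number
   of vertices of K' listed so far; 12 and 13 the coordinates t and c of the
   table; 15 and 16 the values of taking and of leaving the vertex; 6 and 14 are
   scratch. *)
Definition prog_argmin : prog :=
  Seq (Assign 3 (Reg 1))
  (For 4 (Reg 0)
    (Seq (Assign 6 (Lit 0))
    (Seq (For 5 (Reg 0) (Assign 6 (Bin Add (Reg 6) (Adj 4 5))))
         (If (Bin Ltn (Reg 6) (Reg 3))
            (Seq (Assign 3 (Reg 6)) (Assign 2 (Reg 4))) Skip)))).

Definition prog_label : prog :=
  For 4 (Reg 0)
    (Write (Cell LAB (Reg 4))
       (Bin Eqn (Bin Add (Adj 2 4) (Bin Eqn (Reg 2) (Reg 4))) (Lit 0))).

(** The comparison of labels is tested as a strict one against the successor. Vertices already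
    listed, and the candidate itself, pass at once. *)
Definition prog_test : prog :=
  For 5 (Reg 0)
    (If (Bin Add (Bin Add (Read (Cell DONE (Reg 5))) (Bin Eqn (Reg 5) (Reg 4)))
          (Bin Eqn (Adj 4 5)
             (Bin Ltn (Read (Cell LAB (Reg 5)))
                (Bin Add (Read (Cell LAB (Reg 4))) (Lit 1)))))
       Skip (Assign 6 (Lit 0))).

Definition prog_next : prog :=
  For 4 (Reg 0)
    (Seq (Assign 6 (Bin Eqn (Read (Cell DONE (Reg 4))) (Lit 0)))
    (Seq prog_test
         (If (Reg 6) (Assign 8 (Reg 4)) Skip))).

Definition prog_order : prog :=
  Seq (Assign 9 (Lit 0))
  (For 7 (Reg 0)
    (Seq prog_next
    (Seq (Write (Cell ORD (Reg 7)) (Reg 8))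
    (Seq (Write (Cell DONE (Reg 8)) (Lit 1))
    (Seq (Write (Cell PRE (Reg 7)) (Reg 9))
         (Assign 9 (Bin Add (Reg 9) (Read (Cell LAB (Reg 8)))))))))).

Definition GainIn : expr :=
  Bin Add (Bin Mul (Reg 10) (Bin Sub (Reg 11) (Reg 13)))
          (Bin Mul (Bin Sub (Lit 1) (Reg 10)) (Bin Sub (Reg 7) (Reg 12))).
Definition GainOut : expr :=
  Bin Add (Bin Mul (Reg 10) (Reg 13)) (Bin Mul (Bin Sub (Lit 1) (Reg 10)) (Reg 12)).
Definition Next (r : nat) := Bin Add (Reg r) (Lit 1).
Definition ValueIn : expr :=
  Bin Add GainIn (Read (Enc TAB (Next 7) (Next 12) (Bin Add (Reg 13) (Reg 10)))).
Definition ValueOut : expr :=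
  Bin Add GainOut (Read (Enc TAB (Next 7) (Reg 12) (Reg 13))).

Lemma cost_ValueIn : cost ValueIn <= 40.
Proof. by rewrite /= cost_Enc. Qed.

Lemma cost_ValueOut : cost ValueOut <= 40.
Proof. by rewrite /= cost_Enc. Qed.


Definition prog_load : prog :=
  Seq (Assign 8 (Read (Cell ORD (Reg 7))))
  (Seq (Assign 10 (Read (Cell LAB (Reg 8))))
       (Assign 11 (Read (Cell PRE (Reg 7))))).

(** As subtraction is truncated, adding [Bin Sub (Reg 15) (Reg 16)] to register 16 gives the maximum
    of the two values. *)
Definition prog_row : prog :=
  For 12 (Next 7) (For 13 (Next 7)
    (Seq (Assign 15 ValueIn)
    (Seq (Assign 16 ValueOut)
         (Write (Enc TAB (Reg 7) (Reg 12) (Reg 13))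
            (Bin Add (Reg 16) (Bin Sub (Reg 15) (Reg 16))))))).

(** [For] counts upwards, so the position is [n] minus the successor of the counter. *)
Definition prog_table : prog :=
  For 14 (Reg 0)
    (Seq (Assign 7 (Bin Sub (Reg 0) (Next 14)))
    (Seq prog_load prog_row)).

(** The indicator of [S] overwrites part of the adjacency matrix, which is no longer read once the
    order is known. Ties are resolved by taking the vertex. *)
Definition prog_trace : prog :=
  Seq (Assign 12 (Lit 0))
  (Seq (Assign 13 (Lit 0))
  (For 7 (Reg 0)
    (Seq prog_load
    (Seq (Assign 15 ValueIn)
    (Seq (Assign 16 ValueOut)
    (Seq (Assign 6 (Bin Ltn (Reg 16) (Next 15)))
    (Seq (Write (Reg 8) (Reg 6))
    (Seq (Assign 12 (Bin Add (Reg 12) (Reg 6)))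
         (Assign 13 (Bin Add (Reg 13) (Bin Mul (Reg 6) (Reg 10)))))))))))).

Definition prog_maxcut : prog :=
  Seq (Assign 1 (Next 0))
  (Seq prog_argmin (Seq prog_label (Seq prog_order (Seq prog_table
  (Seq prog_trace
       (Assign 0 (Read (Enc TAB (Lit 0) (Lit 0) (Lit 0))))))))).

(** * Word size, addresses and evaluation of expressions *)

Section Correct.
Context (w n : nat) (E : rel nat).
Local Notation M := n.+1.
Local Notation B := (2 ^ w).
Context (roomy : 8 * (M * M * M) <= B).

Lemma room2 : 8 * (M * M) <= B.
Proof. by move: roomy; rewrite mulnS; nia. Qed.

Lemma room1 : 8 * M <= B.
Proof. by have := room2; nia. Qed.

Lemma room0 : 8 <= B.
Proof. by have := room1; lia. Qed.

Lemma room_bool (b : bool) : b < B.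
Proof. by have := room0; case: b; lia. Qed.

Lemma room_bool2 (b1 b2 : bool) : b1 + b2 < B.
Proof. by have := room0; case: b1; case: b2; lia. Qed.

Lemma room_bool3 (b1 b2 b3 : bool) : b1 + b2 + b3 < B.
Proof. by have := room0; case: b1; case: b2; case: b3; lia. Qed.

(** The array numbers end at 5, so addresses stay below six times the cube of [M]; the factor 8 in
    [roomy] covers this. *)
Lemma room_enc k a b c : k <= 5 -> a < M -> b < M -> c < M -> enc M k a b c < B.
Proof.
move=> k5 aM bM cM; apply: leq_trans roomy; apply: leq_trans (enc_lt k aM bM cM) _.
by rewrite leq_mul2r; lia.
Qed.

Lemma evN_Enc s k a b c : regs s 1 = M ->
  evN s (Enc k a b c) = enc M k (evN s a) (evN s b) (evN s c).
Proof. by rewrite /Enc -lock /= => ->. Qed.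

Lemma evN_Cell s k a : regs s 1 = M -> evN s (Cell k a) = enc M k 0 0 (evN s a).
Proof. exact: evN_Enc. Qed.

Lemma fits_Enc s k a b c : regs s 1 = M -> k <= 5 ->
  fits B s a -> fits B s b -> fits B s c ->
  evN s a < M -> evN s b < M -> evN s c < M -> fits B s (Enc k a b c).
Proof.
move=> r1 k5 fa fb fc aM bM cM.
have := room_enc k5 aM bM cM; rewrite /enc => lt.
rewrite /Enc -lock /= r1; have := room1.
by do ?split => //; nia.
Qed.

Lemma fits_Cell s k a : regs s 1 = M -> k <= 5 -> fits B s a -> evN s a < M ->
  fits B s (Cell k a).
Proof. by move=> r1 k5 fa aM; apply: fits_Enc => //=; have := room0; lia. Qed.

Definition stores_graph (m : nat -> nat) : Prop :=
  forall v u, v < n -> u < n -> m (v * n + u) = E v u.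

Lemma fits_Adj s v u : regs s 0 = n -> regs s v < n -> regs s u < n -> fits B s (Adj v u).
Proof.
by move=> r0 vn un; rewrite /Adj -lock /= r0; have := room2; do ?split => //; nia.
Qed.

Lemma evN_Adj s v u : regs s 0 = n -> stores_graph (mem s) ->
  regs s v < n -> regs s u < n -> evN s (Adj v u) = E (regs s v) (regs s u).
Proof. by rewrite /Adj -lock /= => -> g vn un; rewrite g. Qed.

(** * A vertex of minimum degree *)

Definition degree (v : nat) : nat := \sum_(0 <= u < n) E v u.

Lemma wp_argmin s : regs s 0 = n -> regs s 1 = M -> stores_graph (mem s) ->
  wp w prog_argmin (fun s' => 0 < n ->
    regs s' 2 < n /\ forall v, v < n -> degree (regs s' 2) <= degree v) s
    (n * (n * 30 + 60) + 30).
Proof.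
move=> r0 r1 g.
have R1 := room1.
apply: (@wp_seq _ 2 (n * (n * 30 + 60) + 28)); last lia.
apply: wp_assign => //=.
have degn v : degree v <= n.
  rewrite -[leqRHS]muln1 -[n in leqRHS]subn0 -sum_nat_const_nat.
  by apply: leq_sum => i _; case: (E v i).
(* Register 3 starts at [M], which exceeds every degree, so the first vertex replaces it and the
   first alternative survives only for [n = 0]. *)
pose I i (s : state) := (forall v, v < i -> regs s 3 <= degree v) /\
  (regs s 3 = M \/ regs s 2 < n /\ regs s 3 = degree (regs s 2)).
apply: (@wp_for _ I n (n * 30 + 40)) => //=; rewrite ?r1; try lia.
- by split=> //; left.
- by move=> s' [fr _]; rewrite fr // r0.
- move=> i s1 ilt [fr [//|fm]] r4 [bnd opt].
  have {}r0 : regs s1 0 = n by rewrite fr.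
  rewrite /= in fm; rewrite -fm in g.
  apply: (@wp_seq _ 2 (n * 30 + 38)); last lia.
  apply: wp_assign => //=; first by have := room0; lia.
  apply: (@wp_seq _ (n * 30 + 10) 20); last lia.
  apply: wp_mono (leqnn _) _.
    apply: wp_frame.
    apply: (@wp_for _ (fun j s2 => regs s2 6 = \sum_(0 <= u < j) E i u) n 10
              _ _ _ (fun s2 => regs s2 6 = degree i)) => //=; try lia.
    + by rewrite big_geq.
    + by move=> s2 [fr2 _]; rewrite fr2.
    + move=> j s2 jlt [fr2 [//|fm2]] r5 r6.
      have r02 : regs s2 0 = n by rewrite fr2.
      have r42 : regs s2 4 = i by rewrite fr2.
      have g2 : stores_graph (mem s2) by rewrite fm2.
      have ev : evN s2 (Adj 4 5) = E i j by rewrite evN_Adj ?r42 ?r5.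
      have fi : fits B s2 (Adj 4 5) by apply: fits_Adj; rewrite ?r42 ?r5.
      have le : regs s2 6 + E i j < B.
        rewrite r6 -big_nat_recr //=; apply: leq_ltn_trans (_ : n < B); last lia.
        apply: leq_trans (_ : j.+1 <= n) => //.
        rewrite -[leqRHS]muln1 -[j.+1 in leqRHS]subn0 -sum_nat_const_nat.
        by apply: leq_sum => u _; case: (E i u).
      apply: wp_assign; rewrite /= ?cost_read // ev // /update /=.
      by rewrite big_nat_recr //= -r6.
  move=> s2 [[fr2 _] r6] /=.
  have r42 : regs s2 4 = i by rewrite fr2.
  have r32 : regs s2 3 = regs s1 3 by rewrite fr2.
  have r22 : regs s2 2 = regs s1 2 by rewrite fr2.
  apply: (@wp_if _ 10) => //=.
  + by do ?split=> //; exact: room_bool.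
  + rewrite r6 r32 eqb0 negbK => lt; apply: (@wp_seq _ 4 4) => //.
    apply: wp_assign => //; apply: wp_assign => //=.
    split=> /= [v|]; last by right; rewrite /update /= r6 r42.
    rewrite /update /= r6 ltnS leq_eqVlt => /predU1P[-> //|/bnd].
    by apply: leq_trans; exact: ltnW.
  + rewrite r6 r32 => ge; apply: wp_skip => //; split=> /=.
      rewrite /update /= r32 => v; rewrite ltnS leq_eqVlt => /predU1P[->|/bnd //].
      by move/eqP: ge; rewrite eqb0 -leqNgt.
    by rewrite /update /= r32 r22; exact: opt.
- move=> s' _ [bnd [eq|[u ueq]]] n0; last by split=> // v /bnd; rewrite ueq.
  by have := leq_trans (bnd 0 n0) (degn 0); rewrite eq ltnn.
Qed.


(** * Arrays in memory and their separation *)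

Lemma update_enc_low m k a b c v j : 0 < k -> j < M * M ->
  update m (enc M k a b c) v j = m j.
Proof.
move=> k0 jM; rewrite /update; case: eqP => // eq.
by have := enc_ge M a b c k0; rewrite -eq; nia.
Qed.

Lemma stores_graph_update m k a b c v : 0 < k -> stores_graph m ->
  stores_graph (update m (enc M k a b c) v).
Proof. by move=> k0 g u u' un u'n; rewrite update_enc_low // ?g //; nia. Qed.

Definition stores (k : nat) (f : nat -> nat) (N : nat) (m : nat -> nat) : Prop :=
  forall j, j < N -> m (enc M k 0 0 j) = f j.

Lemma stores_update m k f N k' a b c v : k != k' -> N <= n -> a < M -> b < M -> c < M ->
  stores k f N m -> stores k f N (update m (enc M k' a b c) v).
Proof.
move=> kk Nn aM bM cM st j jN; rewrite update_enc ?(negbTE kk) //; first exact: st.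
by lia.
Qed.

Lemma stores_updateS m k f N v : N < n -> v = f N -> stores k f N m ->
  stores k f N.+1 (update m (enc M k 0 0 N) v).
Proof.
move=> Nn vf st j; rewrite ltnS => jN; rewrite update_enc ?eqxx //=; try lia.
by case: eqVneq => [->|ne] //; apply: st; lia.
Qed.

Definition blank (k : nat) (m : nat -> nat) : Prop :=
  forall a b c, a < M -> b < M -> c < M -> m (enc M k a b c) = 0.

Lemma blank_update m k k' a b c v : k != k' -> a < M -> b < M -> c < M ->
  blank k m -> blank k (update m (enc M k' a b c) v).
Proof.
move=> kk aM bM cM bl a' b' c' a'M b'M c'M.
by rewrite update_enc // (negbTE kk) /= bl.
Qed.

(** * Labels and the order of the vertices *)

Context (u : nat).
Definition label : pred nat := far E u.

Lemma wp_label s : regs s 0 = n -> regs s 1 = M -> regs s 2 = u -> (0 < n -> u < n) ->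
  stores_graph (mem s) -> (forall k, 0 < k <= 5 -> blank k (mem s)) ->
  wp w prog_label (fun s' => [/\ stores_graph (mem s'), stores LAB label n (mem s')
    & forall k, 1 < k <= 5 -> blank k (mem s')]) s (n * 100 + 100).
Proof.
move=> r0 r1 r2 un g bl; have R1 := room1.
apply: (@wp_for _ (fun i s' => [/\ stores_graph (mem s'), stores LAB label i (mem s')
    & forall k, 1 < k <= 5 -> blank k (mem s')]) n 40) => //=; try lia.
- by split=> // k /andP[k1 k5]; apply: bl; rewrite k5 (ltnW k1).
- by move=> s' [fr _]; rewrite fr.
move=> i s1 ilt [fr _] r4 [g1 l1 bl1].
have r01 : regs s1 0 = n by rewrite fr.
have r11 : regs s1 1 = M by rewrite fr.
have r21 : regs s1 2 = u by rewrite fr.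
have un' : u < n by apply: un; lia.
have fa : fits B s1 (Adj 2 4) by apply: fits_Adj; rewrite ?r21 ?r4.
have ea : evN s1 (Adj 2 4) = E u i by rewrite evN_Adj ?r21 ?r4.
apply: wp_write => //=.
- by apply: fits_Cell => //=; lia.
- rewrite ea r21 r4; have R0 := room0.
  by do ?split=> //; try exact: room_bool; try lia; case: (E u i); case: (u == i); rewrite /=; lia.
2: by rewrite !cost_read.
rewrite /setr /setm evN_Cell //= ea r21 r4.
split; first exact: stores_graph_update.
- apply: stores_updateS => //; rewrite /label /far.
  by case: (E u i); case: (u == i).
- move=> k /andP[k1 k5]; apply: blank_update => //; last exact: bl1 (introT andP (conj k1 k5)).
  by rewrite neq_ltn k1 orbT.
  by lia.
Qed.

Definition first_below (D : pred nat) (v i : nat) : bool :=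
  all (fun x => [|| D x, x == v | precedes E label v x]) (iota 0 i).
Arguments first_below : simpl never.

Lemma first_belowS D v i : first_below D v i.+1 =
  [|| D i, i == v | precedes E label v i] && first_below D v i.
Proof. by rewrite /first_below -addn1 iotaD all_cat /= andbT andbC. Qed.

Definition ready (D : pred nat) (v : nat) : bool := ~~ D v && first_below D v n.

Lemma wp_test s (D : pred nat) v : regs s 0 = n -> regs s 1 = M -> regs s 4 = v -> v < n ->
  regs s 6 = ~~ D v ->
  stores_graph (mem s) -> stores LAB label n (mem s) -> stores DONE D n (mem s) ->
  wp w prog_test (fun s' => regs s' 6 = ready D v) s (n * 150 + 100).
Proof.
move=> r0 r1 r4 vn r6 g l d; have R1 := room1; have R0 := room0.
apply: (@wp_for _ (fun i s' => regs s' 6 =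
    ~~ D v && first_below D v i) n 80) => //=.
- by lia.
- by lia.
- by rewrite /update /= r6 andbT.
- by move=> s' [fr _]; rewrite fr.
- move=> i s1 ilt [fr [//|fm]] r5; rewrite /= in fm.
  rewrite -fm in g l d => r61.
  have r01 : regs s1 0 = n by rewrite fr.
  have r11 : regs s1 1 = M by rewrite fr.
  have r41 : regs s1 4 = v by rewrite fr.
  have fa : fits B s1 (Adj 4 5) by apply: fits_Adj; rewrite ?r41 ?r5.
  have ea : evN s1 (Adj 4 5) = E v i by rewrite evN_Adj ?r41 ?r5.
  have f5 k : k <= 5 -> fits B s1 (Cell k (Reg 5)) by move=> k5; apply: fits_Cell => //=; lia.
  have f4 k : k <= 5 -> fits B s1 (Cell k (Reg 4)) by move=> k5; apply: fits_Cell => //=; lia.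
  have e5 k : evN s1 (Cell k (Reg 5)) = enc M k 0 0 i by rewrite evN_Cell //= r5.
  have e4 k : evN s1 (Cell k (Reg 4)) = enc M k 0 0 v by rewrite evN_Cell //= r41.
  apply: (@wp_if _ 5) => /=; rewrite ?cost_read //.
  + rewrite !e5 !e4 d // !l // r5 r41 ea.
    do ?split=> //; try by [exact: f5|exact: f4].
    * exact: room_bool.
    * exact: room_bool2.
    (* The literal 1 is the boolean [true] under the coercion, so the bounds on booleans apply. *)
    * exact: (room_bool true).
    * exact: (room_bool2 _ true).
    * exact: room_bool.
    * exact: room_bool.
    * exact: room_bool3.
  + rewrite !e5 !e4 d // !l // r5 r41 ea => ne; apply: wp_skip => //=.
    rewrite /update /= first_belowS r61.
    suff -> : [|| D i, i == v | precedes E label v i] by [].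
    move: ne; rewrite /precedes; case: (D i) => //; case: (i == v) => //.
    by case: (E v i); case: (label i); case: (label v).
  + rewrite !e5 !e4 d // !l // r5 r41 ea => eq; apply: wp_assign => //=; first lia.
    rewrite /update /= first_belowS.
    suff -> : [|| D i, i == v | precedes E label v i] = false by rewrite andbF.
    move: eq; rewrite /precedes; case: (D i) => //; case: (i == v) => //.
    by case: (E v i); case: (label i); case: (label v).
- by lia.
Qed.

Lemma wp_next s (D : pred nat) : regs s 0 = n -> regs s 1 = M ->
  stores_graph (mem s) -> stores LAB label n (mem s) -> stores DONE D n (mem s) ->
  (exists2 v, v < n & ready D v) ->
  wp w prog_next (fun s' => regs s' 8 < n /\ ready D (regs s' 8)) s (n * (n * 150 + 200) + 100).
Proof.
move=> r0 r1 g l d [v0 v0n v0r]; have R1 := room1; have R0 := room0.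
(* The scan has no early exit and keeps the last ready candidate. The invariant is an implication
   because register 8 is arbitrary until one has been met. *)
apply: (@wp_for _ (fun i s' => (exists2 v, v < i & ready D v) ->
    regs s' 8 < n /\ ready D (regs s' 8)) n (n * 150 + 150)) => //=.
- by lia.
- by lia.
- by case=> v; rewrite ltn0.
- by move=> s' [fr _]; rewrite fr.
- move=> i s1 ilt [fr [//|fm]] r4; rewrite /= in fm.
  rewrite -fm in g l d => IH.
  have r01 : regs s1 0 = n by rewrite fr.
  have r11 : regs s1 1 = M by rewrite fr.
  have e4 k : evN s1 (Cell k (Reg 4)) = enc M k 0 0 i by rewrite evN_Cell //= r4.
  apply: (@wp_seq _ 20 (n * 150 + 120)); last lia.
  apply: wp_assign => /=; rewrite ?cost_read //.
    rewrite e4 d //; split=> //; try exact: room_bool; try lia.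
    by apply: fits_Cell => //=; lia.
  rewrite e4 d // eqb0.
  apply: (@wp_seq _ (n * 150 + 100) 20); last lia.
  have := @wp_test (setr s1 6 (~~ D i)) D i r01 r11 r4 ilt erefl g l d.
  move/wp_frame/wp_mono; apply=> // s2 [[fr2 _]] r6.
  have r42 : regs s2 4 = i by rewrite fr2.
  have r82 : regs s2 8 = regs s1 8 by rewrite fr2.
  apply: (@wp_if _ 5) => //=.
  + rewrite r6 eqb0 negbK => rd; apply: wp_assign => //= _.
    by rewrite /update /= r42.
  + rewrite r6 => /eqP; rewrite eqb0 => nrd; apply: wp_skip => //=.
    rewrite /update /= r82 => -[v]; rewrite ltnS leq_eqVlt => /predU1P[->|vi] vr.
      by rewrite vr in nrd.
    by apply: IH; exists v.
- by move=> s' _; apply; exists v0.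
- by lia.
Qed.


(** [order_below] is what allows an extension: listed vertices already have the right adjacency to
    all unlisted ones, so appending any of these preserves [order_pairwise]. *)
Record order_inv (i : nat) (vs : seq nat) (s : state) : Prop := OrderInv {
  order_size : size vs = i;
  order_uniq : uniq vs;
  order_lt : forall v, v \in vs -> v < n;
  order_pairwise : pairwise (precedes E label) vs;
  order_below : forall v x, v \in vs -> x < n -> x \notin vs -> precedes E label v x;
  order_graph : stores_graph (mem s);
  order_lab : stores LAB label n (mem s);
  order_done : stores DONE (fun v => v \in vs) n (mem s);
  order_ord : stores ORD (nth 0 vs) i (mem s);
  order_pre : stores PRE (fun j => count label (take j vs)) i (mem s);
  order_count : regs s 9 = count label vs;
  order_tab : blank TAB (mem s)
}.

Context (next_exists : forall vs, uniq vs -> (forall v, v \in vs -> v < n) -> size vs < n ->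
  exists2 v, v < n & ready (fun v => v \in vs) v).

Lemma order_inv_step i vs s s' v : i < n -> v < n -> order_inv i vs s ->
  ready (fun v => v \in vs) v ->
  mem s' = update (update (update (mem s) (enc M ORD 0 0 i) v) (enc M DONE 0 0 v) 1)
             (enc M PRE 0 0 i) (count label vs) ->
  regs s' 9 = count label vs + label v ->
  order_inv i.+1 (rcons vs v) s'.
Proof.
move=> ilt vn [sz un lt pw below g l d o p cnt tab] /andP[nv /allP fb] ms r9.
have iM : i < M by lia.
have vM : v < M by lia.
have i0 : 0 < M by [].
split.
- by rewrite size_rcons sz.
- by rewrite rcons_uniq nv.
- by move=> x; rewrite mem_rcons inE => /predU1P[->//|]; exact: lt.
- rewrite pairwise_rcons pw andbT; apply/allP => x xvs; exact: below.
- move=> x y; rewrite !mem_rcons !inE negb_or => /predU1P[->|xvs] yn /andP[yv yvs].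
    by have := fb y; rewrite mem_iota /= add0n yn (negbTE yvs) (negbTE yv) => /(_ isT).
  exact: below.
- by rewrite ms; do 3?apply: stores_graph_update.
- by rewrite ms; do 3?apply: stores_update.
- rewrite ms; apply: stores_update => // x xn.
  rewrite update_enc //=; last lia.
  rewrite mem_rcons inE; case: eqVneq => //= _.
  by rewrite update_enc ?d //; lia.
- rewrite ms; do 2?apply: stores_update => //.
  apply: stores_updateS => // [|j jlt]; first by rewrite nth_rcons sz ltnn eqxx.
  by rewrite nth_rcons sz jlt o.
- rewrite ms; apply: stores_updateS => //.
    by rewrite -cats1 take_cat sz ltnn subnn take0 cats0.
  do 2?apply: stores_update => //; try lia.
  move=> j jlt; rewrite p // -cats1 take_cat sz jlt.
  by [].
- by rewrite r9 -cats1 count_cat /= addn0.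
- by rewrite ms; do 3?apply: blank_update.
Qed.

Lemma wp_order s : regs s 0 = n -> regs s 1 = M ->
  stores_graph (mem s) -> stores LAB label n (mem s) ->
  (forall k, 1 < k <= 5 -> blank k (mem s)) ->
  wp w prog_order (fun s' => exists vs, order_inv n vs s') s
    (n * (n * (n * 150 + 200) + 300) + 100).
Proof.
move=> r0 r1 g l bl; have R1 := room1; have R0 := room0.
apply: (@wp_seq _ 2 (n * (n * (n * 150 + 200) + 300) + 80)); last lia.
apply: wp_assign => //=; first lia.
apply: (@wp_for _ (fun i s' => exists vs, order_inv i vs s') n
          (n * (n * 150 + 200) + 250)) => //=.
- by lia.
- by lia.
- exists [::]; split=> //=; first by move=> v vn; rewrite bl //=; lia.
  exact: (bl TAB).
- by move=> s' [fr _]; rewrite fr.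
- move=> i s1 ilt [fr _] r7 [vs inv]; have [sz un lt pw below g1 l1 d1 o1 p1 cnt tab] := inv.
  have r01 : regs s1 0 = n by rewrite fr.
  have r11 : regs s1 1 = M by rewrite fr.
  have ex : exists2 v, v < n & ready (fun v => v \in vs) v.
    by apply: next_exists => //; rewrite sz.
  apply: (@wp_seq _ (n * (n * 150 + 200) + 100) 150); last lia.
  have := @wp_next s1 _ r01 r11 g1 l1 d1 ex.
  move/wp_frame/wp_mono; apply=> // s2 [[fr2 [//|fm2]] [vn vr]]; rewrite /= in fm2.
  have r02 : regs s2 0 = n by rewrite fr2.
  have r12 : regs s2 1 = M by rewrite fr2.
  have r72 : regs s2 7 = i by rewrite fr2.
  have r92 : regs s2 9 = count label vs by rewrite fr2.
  have fc k r s3 : k <= 5 -> regs s3 1 = M -> regs s3 r < n -> fits B s3 (Cell k (Reg r)).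
    by move=> k5 r13 rlt; apply: fits_Cell => //=; lia.
  have cntn : count label vs <= n by apply: leq_trans (count_size _ _) _; lia.
  apply: (@wp_seq _ 20 100) => //.
  apply: wp_write; rewrite /= ?cost_read //; first by apply: fc; rewrite ?r72.
  rewrite evN_Cell //= r72.
  apply: (@wp_seq _ 20 80) => //.
  apply: wp_write; rewrite /= ?cost_read //; first exact: fc.
    by lia.
  rewrite evN_Cell //=.
  apply: (@wp_seq _ 20 60) => //.
  apply: wp_write; rewrite /= ?cost_read //; first by apply: fc; rewrite //= r72.
  rewrite evN_Cell //= r72 r92.
  have lv : update (update (update (mem s2) (enc M ORD 0 0 i) (regs s2 8))
      (enc M DONE 0 0 (regs s2 8)) 1) (enc M PRE 0 0 i) (count label vs)
      (enc M LAB 0 0 (regs s2 8)) = label (regs s2 8).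
    by rewrite !update_enc //= ?fm2 ?l1 //; lia.
  apply: wp_assign; rewrite /= ?cost_read //.
    rewrite evN_Cell //= lv; split=> //; first exact: fc.
    by rewrite r92; case: (label _); lia.
  rewrite evN_Cell //= lv; exists (rcons vs (regs s2 8)).
  apply: order_inv_step ilt vn inv vr _ _ => /=; first by rewrite fm2.
  by rewrite /update /= r92.
- by lia.
Qed.


(** * The values of the dynamic program *)

Context (vs : seq nat) (vs_size : size vs = n) (vs_lt : forall v, v \in vs -> v < n).

Definition labels_before (i : nat) : nat := count label (take i vs).

(** On triples that no [S] realizes, truncated subtraction makes the gains meaningless, but the
    values still obey the same recursion and bounds, so the table can be filled without case
    distinctions. *)
Definition value (i t c : nat) : nat :=
  best_gain (map label (drop i vs)) i (labels_before i) t c.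

Definition value_in (i t c : nat) : nat :=
  let l := label (nth 0 vs i) in
  gain_in l i (labels_before i) t c + value i.+1 t.+1 (c + l).

Definition value_out (i t c : nat) : nat :=
  gain_out (label (nth 0 vs i)) t c + value i.+1 t c.

Lemma nth_vs_lt i : i < n -> nth 0 vs i < n.
Proof. by move=> ilt; apply: vs_lt; rewrite mem_nth ?vs_size. Qed.

Lemma labels_before_le i : labels_before i <= i.
Proof. by apply: leq_trans (count_size _ _) _; rewrite size_take; case: ltnP. Qed.

Lemma valueE i t c : i < n -> value i t c = maxn (value_in i t c) (value_out i t c).
Proof.
move=> ilt; rewrite /value_in /value_out /value /labels_before.
by rewrite (drop_nth 0) ?vs_size //= (take_nth 0) ?vs_size // -cats1 count_cat /= addn0.
Qed.

Lemma value_le i t c : i <= n -> t <= i -> c <= i -> value i t c <= n * n.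
Proof.
move=> ilt ti ci; apply: leq_trans (@best_gain_bound n _ _ _ _ _ _ _ _ _) _ => //.
- by rewrite size_map size_drop vs_size subnKC.
- exact: labels_before_le.
- by rewrite leq_mul2r size_map size_drop vs_size leq_subr orbT.
Qed.

Definition has_order (m : nat -> nat) : Prop :=
  [/\ stores LAB label n m, stores ORD (nth 0 vs) n m & stores PRE labels_before n m].

Lemma wp_load s i : i < n -> regs s 7 = i -> regs s 1 = M -> has_order (mem s) ->
  wp w prog_load (fun s' => [/\ regs s' 8 = nth 0 vs i, regs s' 10 = label (nth 0 vs i)
    & regs s' 11 = labels_before i]) s 80.
Proof.
move=> ilt r7 r1 [l o p]; have R1 := room1; have vn := nth_vs_lt ilt.
have fc k r s3 : k <= 5 -> regs s3 1 = M -> regs s3 r < n -> fits B s3 (Cell k (Reg r)).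
  by move=> k5 r13 rlt; apply: fits_Cell => //=; lia.
apply: (@wp_seq _ 20 60) => //.
apply: wp_assign; rewrite /= ?cost_read // ?evN_Cell //= ?r7 ?o //.
  by apply: fc; rewrite ?r7.
apply: (@wp_seq _ 20 40) => //.
apply: wp_assign; rewrite /= ?cost_read // ?evN_Cell //= /update /= ?l //.
  exact: fc.
apply: wp_assign; rewrite /= ?cost_read // ?evN_Cell //= /update /= ?r7 ?p //.
by apply: fc; rewrite //= /update /= r7.
Qed.

(** Filling the table and tracing it evaluate the same two expressions. Of the table, both need only
    row [i.+1]. *)
Record at_state (i t c : nat) (s : state) : Prop := AtState {
  at_base : regs s 1 = M;
  at_pos : regs s 7 = i;
  at_label : regs s 10 = label (nth 0 vs i);
  at_before : regs s 11 = labels_before i;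
  at_t : regs s 12 = t;
  at_c : regs s 13 = c;
  at_lt : i < n;
  at_tle : t <= i;
  at_cle : c <= i;
  at_next : forall t' c', t' <= i.+1 -> c' <= i.+1 ->
    mem s (enc M TAB i.+1 t' c') = value i.+1 t' c'
}.

Lemma gain_in_le i t c : i <= n -> gain_in (label (nth 0 vs i)) i (labels_before i) t c <= n.
Proof.
move=> ilt; rewrite /gain_in; have := labels_before_le i.
by case: (label _) => /=; lia.
Qed.

Lemma gain_out_le i t c : t <= n -> c <= n -> gain_out (label (nth 0 vs i)) t c <= n.
Proof. by move=> ti ci; rewrite /gain_out; case: (label _) => /=; lia. Qed.

Lemma value_in_le i t c : i < n -> t <= i -> c <= i -> value_in i t c <= n * n + n.
Proof.
move=> ilt ti ci; have := gain_in_le t c (ltnW ilt).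
have := @value_le i.+1 t.+1 (c + label (nth 0 vs i)) ilt ti.
by rewrite /value_in; case: (label _) => /=; rewrite ?addn1 ?addn0 => h; lia.
Qed.

Lemma value_in_lt i t c : i < n -> t <= i -> c <= i -> value_in i t c < B.
Proof. by move=> ilt ti ci; have := value_in_le ilt ti ci; have := room2; nia. Qed.

Lemma value_out_lt i t c : i < n -> t <= i -> c <= i -> value_out i t c < B.
Proof.
move=> ilt ti ci; have := @gain_out_le i t c; have := room2.
have := @value_le i.+1 t c ilt; rewrite /value_out; nia.
Qed.

Lemma eval_value_in i t c s : at_state i t c s ->
  fits B s ValueIn /\ evN s ValueIn = value_in i t c.
Proof.
move=> [r1 r7 r10 r11 r12 r13 ilt ti ci nx]; have R1 := room1; have R0 := room0.
have lb := labels_before_le i.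
have vlt := value_in_lt ilt ti ci.
have glt := gain_in_le t c (ltnW ilt).
have fe : fits B s (Enc TAB (Next 7) (Next 12) (Bin Add (Reg 13) (Reg 10))).
  have b1 := leq_b1 (label (nth 0 vs i)).
  apply: fits_Enc => //=; rewrite ?r7 ?r10 ?r12 ?r13; try lia.
  - split=> //; lia.
  - split=> //; lia.
  - split=> //. lia.
have rd : mem s (evN s (Enc TAB (Next 7) (Next 12) (Bin Add (Reg 13) (Reg 10)))) =
    value i.+1 t.+1 (c + label (nth 0 vs i)).
  rewrite evN_Enc //= r7 r10 r12 r13 !addn1 nx //.
  by case: (label _); rewrite ?addn1 ?addn0; lia.
rewrite /= rd r7 r10 r11 r12 r13; split; last by [].
move: vlt glt; rewrite /value_in /gain_in; case: (label _) => /= vlt glt.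
all: by do ?split => //; lia.
Qed.

Lemma eval_value_out i t c s : at_state i t c s ->
  fits B s ValueOut /\ evN s ValueOut = value_out i t c.
Proof.
move=> [r1 r7 r10 r11 r12 r13 ilt ti ci nx]; have R1 := room1; have R0 := room0.
have vlt := value_out_lt ilt ti ci.
have fe : fits B s (Enc TAB (Next 7) (Reg 12) (Reg 13)).
  apply: fits_Enc => //=; rewrite ?r7 ?r12 ?r13; try lia.
  by do ?split => //; lia.
have rd : mem s (evN s (Enc TAB (Next 7) (Reg 12) (Reg 13))) = value i.+1 t c.
  by rewrite evN_Enc //= r7 r12 r13 !addn1 nx // ltnW // ltnS.
rewrite /= rd r10 r12 r13; split; last by [].
move: vlt; rewrite /value_out /gain_out; case: (label _) => /= vlt.
all: by do ?split => //; lia.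
Qed.

(* The table is filled for decreasing i, then increasing t, then increasing c. *)
Definition before (i t c i' t' c' : nat) : bool :=
  (i < i') || (i == i') && ((t' < t) || (t' == t) && (c' < c)).

Definition tabled (i t c : nat) (m : nat -> nat) : Prop :=
  forall i' t' c', before i t c i' t' c' -> i' <= n -> t' <= i' -> c' <= i' ->
    m (enc M TAB i' t' c') = value i' t' c'.

Lemma tabled_sub i t c j t1 c1 m : tabled i t c m ->
  (forall i' t' c', before j t1 c1 i' t' c' -> t' <= i' -> c' <= i' ->
     before i t c i' t' c') -> tabled j t1 c1 m.
Proof. by move=> tb sub i' t' c' /sub bf i'n ti' ci'; apply: tb => //; exact: bf. Qed.

Lemma has_order_update m i t c v : i < M -> t < M -> c < M -> has_order m ->
  has_order (update m (enc M TAB i t c) v).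
Proof. by move=> iM tM cM [l o p]; split; apply: stores_update. Qed.

Lemma wp_row s i : i < n -> regs s 1 = M -> regs s 7 = i ->
  regs s 10 = label (nth 0 vs i) -> regs s 11 = labels_before i ->
  has_order (mem s) -> tabled i 0 0 (mem s) ->
  wp w prog_row (fun s' => has_order (mem s') /\ tabled i i.+1 0 (mem s')) s
    (M * (M * 200 + 100) + 100).
Proof.
move=> ilt r1 r7 r10 r11 ho tb; have R1 := room1; have R0 := room0.
apply: (@wp_for _ (fun t s' => has_order (mem s') /\ tabled i t 0 (mem s')) i.+1
          (M * 200 + 50)) => //=.
- by lia.
- by lia.
- by move=> s' [fr _]; rewrite fr // r7 addn1; split=> //; split=> //; lia.
- move=> t s1 tlt [fr _] r12 [ho1 tb1].
  have r71 : regs s1 7 = i by rewrite fr.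
  apply: (@wp_for _ (fun c s' => has_order (mem s') /\ tabled i t c (mem s')) i.+1 150) => //=.
  + by lia.
  + by lia.
  + by move=> s' [fr2 _]; rewrite fr2 // r71 addn1; split=> //; split=> //; lia.
  + move=> c s2 clt [fr2 _] r13 [ho2 tb2].
    have st : at_state i t c s2.
      have c1 : regs s2 1 = M by rewrite fr2 // fr.
      have c7 : regs s2 7 = i by rewrite fr2.
      have c10 : regs s2 10 = label (nth 0 vs i) by rewrite fr2 // fr.
      have c11 : regs s2 11 = labels_before i by rewrite fr2 // fr.
      have c12 : regs s2 12 = t by rewrite fr2.
      apply: (AtState c1 c7 c10 c11 c12 r13 ilt) => // t' c' t'i c'i.
      by apply: tb2 => //; rewrite /before ltnSn.
    have [fi ei] := eval_value_in st.
    apply: (@wp_seq _ 50 100) => //.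
    apply: wp_assign => //; last by apply: leq_ltn_trans cost_ValueIn _.
    rewrite ei.
    have st3 : at_state i t c (setr s2 15 (value_in i t c)) by case: st.
    have [fo eo] := eval_value_out st3.
    apply: (@wp_seq _ 50 50) => //.
    apply: wp_assign => //; last by apply: leq_ltn_trans cost_ValueOut _.
    rewrite eo.
    have [r1' r7' _ _ r12' r13' _ ti ci _] := st.
    have vi := value_in_lt ilt ti ci.
    have vo := value_out_lt ilt ti ci.
    apply: wp_write => //=.
    * by apply: fits_Enc => //=; rewrite /update /= ?r7' ?r12' ?r13'; lia.
    * by rewrite /update /=; do ?split => //; lia.
    * rewrite evN_Enc //= /update /= -/(update _ _ _) r7' r12' r13' -maxnE maxnC.
      split; first by apply: has_order_update => //; lia.
      move=> i' t' c' bf i'n t'i' c'i'; rewrite update_enc; try lia.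
      case: and4P => [[_ /eqP-> /eqP-> /eqP->]|ne]; first by rewrite valueE.
      apply: tb2 => //; move: bf; rewrite /before ltnS [c' <= c]leq_eqVlt.
      case: ltngtP => //= ii; case: ltngtP => //= tt; case: eqVneq => //= cc.
      by case: ne; rewrite ii tt cc !eqxx.
    * by rewrite cost_Enc.
  (* Within row [i] every [c'] is at most [i], so the end of line [t] is the start of line
     [t.+1]. *)
  + move=> s' _ [ho' tb']; split=> //; apply: tabled_sub tb' _ => i' t' c'.
    rewrite /setr /before /=; lia.
  + by lia.
- rewrite mulSn; nia.
Qed.


Definition full_table (m : nat -> nat) : Prop :=
  forall i t c, i <= n -> t <= i -> c <= i -> m (enc M TAB i t c) = value i t c.

Lemma wp_table s : regs s 0 = n -> regs s 1 = M -> has_order (mem s) -> blank TAB (mem s) ->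
  wp w prog_table (fun s' => has_order (mem s') /\ full_table (mem s')) s
    (n * (M * (M * 200 + 100) + 300) + 100).
Proof.
move=> r0 r1 ho bl; have R1 := room1; have R0 := room0.
apply: (@wp_for _ (fun j s' => has_order (mem s') /\ tabled (n - j) (n - j).+1 0 (mem s')) n
          (M * (M * 200 + 100) + 250)) => //=.
- by lia.
- by lia.
(* Row [n] is never written: no vertices remain there, and its value 0 is what blank memory
   holds. *)
- split=> // i t c; rewrite subn0 /before => bf i_n ti ci.
  have -> : i = n by lia.
  by rewrite bl /value ?drop_oversize ?vs_size //; lia.
- by move=> s' [fr _]; rewrite fr.
- move=> j s1 jlt [fr _] r14 [ho1 tb1].
  have r01 : regs s1 0 = n by rewrite fr.
  have r11 : regs s1 1 = M by rewrite fr.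
  apply: (@wp_seq _ 10 (M * (M * 200 + 100) + 200)); last lia.
  apply: wp_assign => //=.
    by rewrite r01 r14; do ?split => //; lia.
  rewrite r01 r14 addn1; have ilt : n - j.+1 < n by lia.
  apply: (@wp_seq _ 80 (M * (M * 200 + 100) + 100)); last lia.
  have := @wp_load (setr s1 7 (n - j.+1)) _ ilt erefl r11 ho1.
  move/wp_frame/wp_mono; apply=> // s2 [[fr2 [//|fm2]] [r8 r10 r11']]; rewrite /= in fm2.
  have r12 : regs s2 1 = M by rewrite fr2.
  have r72 : regs s2 7 = n - j.+1 by rewrite fr2.
  apply: wp_mono (wp_row ilt r12 r72 r10 r11' _ _) _ _ => //; rewrite fm2 //.
  apply: tabled_sub tb1 _ => i' t' c'; rewrite /before; lia.
- move=> s' _ []; rewrite subnn => ho' tb'; split=> // i t c i_n ti ci.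
  by apply: tb' => //; rewrite /before; lia.
- by lia.
Qed.

(** * Recovery of a maximum cut *)

Lemma update_low_enc m k a b c v j : 0 < k -> j < n ->
  update m j v (enc M k a b c) = m (enc M k a b c).
Proof.
move=> k0 jn; rewrite /update; case: eqP => // eq.
by have := enc_ge M a b c k0; rewrite eq; nia.
Qed.

Context (E_sym : symmetric E) (vs_uniq : uniq vs) (vs_order : pairwise (precedes E label) vs).

Lemma value_max S : list_cut E S vs <= value 0 0 0.
Proof.
have := @list_cut_le E label E_sym S [::] vs vs_order.
have -> : list_cut E S [::] = 0 by rewrite /list_cut big_nil.
by rewrite /value drop0 /labels_before take0.
Qed.

(** Each step of the trace gains what the table promises, so the cut so far plus the gain still
    available stays equal to the upper bound of [value_max]. *)
Definition traced (i : nat) (s : state) (S : pred nat) : Prop :=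
  [/\ forall v, v \in take i vs -> mem s v = S v,
      regs s 12 = count S (take i vs), regs s 13 = count (predI S label) (take i vs)
    & list_cut E S (take i vs) + value i (regs s 12) (regs s 13) = value 0 0 0].

Lemma traced_step i s s' S : i < n -> traced i s S ->
  let v := nth 0 vs i in
  let b := value_out i (regs s 12) (regs s 13) <= value_in i (regs s 12) (regs s 13) in
  mem s' = update (mem s) v b -> regs s' 12 = regs s 12 + b ->
  regs s' 13 = regs s 13 + b * label v ->
  traced i.+1 s' (fun x => if x == v then b else S x).
Proof.
move=> ilt [ms r12 r13 tot] v b ms' r12' r13'.
have isz : i < size vs by rewrite vs_size.
have tk : take i.+1 vs = rcons (take i vs) v by rewrite -take_nth.
(* As the list has no repetition, deciding on [v] disturbs neither the memory cells nor the counts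
   of earlier vertices. *)
have vn : v \notin take i vs.
  by move: (take_uniq i.+1 vs_uniq); rewrite tk rcons_uniq => /andP[].
set S' := fun x => _.
have SS x : x \in take i vs -> S' x = S x.
  by rewrite /S'; case: eqVneq => // ->; rewrite (negbTE vn).
have S'v : S' v = b by rewrite /S' eqxx.
have cS : count S' (take i vs) = regs s 12 by rewrite r12; exact: eq_in_count.
have cSL : count (predI S' label) (take i vs) = regs s 13.
  by rewrite r13; apply: eq_in_count => x xP /=; rewrite SS.
split.
- move=> x; rewrite tk mem_rcons inE ms' /update /S'.
  by case: eqVneq => //= _; exact: ms.
- by rewrite tk -cats1 count_cat /= S'v addn0 cS.
- by rewrite tk -cats1 count_cat /= S'v addn0 cSL r13'; case: (b); rewrite ?mul1n ?mul0n.
- have pw : all (precedes E label ^~ v) (take i vs).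
    have := vs_order; rewrite -{1}(cat_take_drop i.+1 vs) pairwise_cat tk pairwise_rcons.
    by case/and3P => _ /andP[].
  rewrite tk (list_cut_rcons E_sym S' pw) (eq_list_cut _ SS) S'v cS cSL -addnA -tot.
  congr (_ + _); rewrite r12' r13' (valueE _ _ ilt) size_take isz /step_gain.
  rewrite -[count label _]/(labels_before i) /b.
  case: leqP => _.
    by rewrite /value_in addn1 mul1n.
  by rewrite /value_out mul0n !addn0.
Qed.

Lemma wp_trace s : regs s 0 = n -> regs s 1 = M -> has_order (mem s) -> full_table (mem s) ->
  wp w prog_trace (fun s' => full_table (mem s') /\ exists S : pred nat,
    (forall v, v \in vs -> mem s' v = S v) /\ list_cut E S vs = value 0 0 0) s
    (n * 400 + 100).
Proof.
move=> r0 r1 ho ft; have R1 := room1; have R0 := room0.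
apply: (@wp_seq _ 2 (n * 400 + 50)); last lia.
apply: wp_assign => //=; first lia.
apply: (@wp_seq _ 2 (n * 400 + 40)); last lia.
apply: wp_assign => //=; first lia.
apply: (@wp_for _ (fun i s' => [/\ has_order (mem s'), full_table (mem s')
    & exists S, traced i s' S]) n 350) => //=.
- by lia.
- by lia.
- split=> //; exists pred0; split; rewrite ?take0 //=.
  by rewrite /list_cut big_nil.
- by move=> s' [fr _]; rewrite fr.
- move=> i s1 ilt [fr _] r7 [ho1 ft1 [S tr]].
  have r11 : regs s1 1 = M by rewrite fr.
  apply: (@wp_seq _ 80 250) => //.
  have := @wp_load s1 _ ilt r7 r11 ho1.
  move/wp_frame/wp_mono; apply=> // s2 [[fr2 [//|fm2]] [r8 r10 rp]]; rewrite /= in fm2.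
  pose t := regs s1 12; pose c := regs s1 13.
  have [_ tE cE _] := tr.
  have ti : t <= i by rewrite /t tE (leq_trans (count_size _ _)) // size_take_min geq_minl.
  have ci : c <= i by rewrite /c cE (leq_trans (count_size _ _)) // size_take_min geq_minl.
  have c1 : regs s2 1 = M by rewrite fr2.
  have c7 : regs s2 7 = i by rewrite fr2.
  have c12 : regs s2 12 = t by rewrite fr2.
  have c13 : regs s2 13 = c by rewrite fr2.
  have st : at_state i t c s2.
    apply: (AtState c1 c7 r10 rp c12 c13 ilt) => // t' c' t'i c'i.
    by rewrite fm2 ft1.
  have [fi ei] := eval_value_in st.
  apply: (@wp_seq _ 50 200) => //.
  apply: wp_assign => //; last by apply: leq_ltn_trans cost_ValueIn _.
  rewrite ei.
  have st3 : at_state i t c (setr s2 15 (value_in i t c)) by case: st.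
  have [fo eo] := eval_value_out st3.
  apply: (@wp_seq _ 50 150) => //.
  apply: wp_assign => //; last by apply: leq_ltn_trans cost_ValueOut _.
  rewrite eo.
  have vn := nth_vs_lt ilt.
  have vi := value_in_lt ilt ti ci.
  have vi2 := value_in_le ilt ti ci.
  have R2 := room2.
  apply: (@wp_seq _ 20 130) => //.
  apply: wp_assign => //=; rewrite /update /= addn1 ltnS.
    by do ?split => //; try exact: room_bool; nia.
  set b := value_out i t c <= value_in i t c.
  have b1 := leq_b1 b; have l1 := leq_b1 (label (nth 0 vs i)).
  apply: (@wp_seq _ 20 100) => //; apply: wp_write => //=.
  apply: (@wp_seq _ 20 80) => //; apply: wp_assign => //=; rewrite /update /= ?c12.
    by split=> //; lia.
  apply: wp_assign => //=; first by rewrite /update /= c13 r10; do ?split => //; nia.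
  rewrite r8 fm2; split=> /=.
  + have [l o p] := ho1.
    split=> j jn; rewrite update_low_enc //; [exact: l|exact: o|exact: p].
  + by move=> i' t' c' i'n t'i c'i; rewrite update_low_enc // ft1.
  + eexists; apply: traced_step ilt tr _ _ _ => /=; first by rewrite fm2.
      by rewrite /update /= ?c12.
    by rewrite /update /= ?c12 ?c13 ?r10.
- move=> s' _ [_ ft' [S [ms _ _ tot]]]; split=> //; exists S.
  rewrite take_oversize ?vs_size // in ms tot; split=> //.
  by move: tot; rewrite /value drop_oversize ?vs_size //= addn0.
- by lia.
Qed.

End Correct.

(** * Correctness on graphs *)

Definition maxcut_time (n : nat) : nat :=
  n * (n * (n * 150 + 230) + 1000) + n * (n.+1 * (n.+1 * 200 + 100) + 300) + 1000.

(** The vertex [u] is known only once the search has run, so the existence of a next vertex is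
    assumed for every [u] of minimum degree. *)
Lemma wp_maxcut w n (E : rel nat) s : 8 * (n.+1 * n.+1 * n.+1) <= 2 ^ w -> symmetric E ->
  (forall u, (0 < n -> u < n /\ forall v, v < n -> degree n E u <= degree n E v) ->
   forall vs, uniq vs -> (forall v, v \in vs -> v < n) -> size vs < n ->
   exists2 v, v < n & ready n E u (fun v => v \in vs) v) ->
  regs s 0 = n -> stores_graph n E (mem s) -> (forall k, 0 < k <= 5 -> blank n k (mem s)) ->
  wp w prog_maxcut (fun s' => exists S : pred nat,
    [/\ forall v, v < n -> mem s' v = S v, regs s' 0 = list_cut E S (iota 0 n)
      & forall S', list_cut E S' (iota 0 n) <= regs s' 0]) s (maxcut_time n).
Proof.
move=> roomy E_sym next r0 g bl; have R1 := room1 roomy; have R0 := room0 roomy.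
have frame_regs p s1 s2 : frame (assigned p) (writes p) s1 s2 ->
    (0 \notin assigned p) && (1 \notin assigned p) ->
    regs s1 0 = n -> regs s1 1 = n.+1 -> regs s2 0 = n /\ regs s2 1 = n.+1.
  by move=> [fr _] /andP[p0 p1]; rewrite !fr.
rewrite /maxcut_time.
apply: (@wp_seq _ 10 (n * (n * (n * 150 + 230) + 990) +
  n * (n.+1 * (n.+1 * 200 + 100) + 300) + 950)); last lia.
apply: wp_assign => //=; first by rewrite r0; do ?split => //; lia.
rewrite r0 addn1.
apply: (@wp_seq _ (n * (n * 30 + 60) + 30) (n * (n * (n * 150 + 200) + 900) +
  n * (n.+1 * (n.+1 * 200 + 100) + 300) + 900)); last lia.
have := wp_frame (@wp_argmin w n E roomy (setr s 1 n.+1) r0 erefl g).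
move/wp_mono; apply=> // s1 [fr1 umin].
have [r01 r11] := frame_regs _ _ _ fr1 isT r0 erefl.
have m1 : mem s1 = mem s by case: fr1 => _ [|].
pose u := regs s1 2.
apply: (@wp_seq _ (n * 100 + 100) (n * (n * (n * 150 + 200) + 800) +
  n * (n.+1 * (n.+1 * 200 + 100) + 300) + 800)); last lia.
have un : 0 < n -> u < n by move=> /umin[].
rewrite -m1 in g bl.
have := wp_frame (wp_label roomy r01 r11 erefl un g bl).
move/wp_mono; apply=> // s2 [fr2 [g2 l2 bl2]].
have [r02 r12] := frame_regs _ _ _ fr2 isT r01 r11.
apply: (@wp_seq _ (n * (n * (n * 150 + 200) + 300) + 100) (n * 500 +
  n * (n.+1 * (n.+1 * 200 + 100) + 300) + 700)); last lia.
have := wp_frame (wp_order roomy (next u umin) r02 r12 g2 l2 bl2).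
move/wp_mono; apply=> // s3 [fr3 [vs inv]].
have [r03 r13] := frame_regs _ _ _ fr3 isT r02 r12.
have [sz un' lt pw _ _ l3 _ o3 p3 _ tab] := inv.
apply: (@wp_seq _ (n * (n.+1 * (n.+1 * 200 + 100) + 300) + 100) (n * 500 + 500)); last lia.
have ho : has_order n E u vs (mem s3) by split.
have := wp_frame (wp_table roomy sz lt r03 r13 ho tab).
move/wp_mono; apply=> // s4 [fr4 [ho4 ft4]].
have [r04 r14] := frame_regs _ _ _ fr4 isT r03 r13.
apply: (@wp_seq _ (n * 400 + 100) 50); last lia.
have := wp_frame (wp_trace roomy sz lt E_sym un' pw r04 r14 ho4 ft4).
move/wp_mono; apply=> // s5 [fr5 [ft5 [S [ms cutS]]]].
have [r05 r15] := frame_regs _ _ _ fr5 isT r04 r14.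
have pe : perm_eq vs (iota 0 n).
  have sub : {subset vs <= iota 0 n} by move=> v /lt; rewrite mem_iota.
  have [_ eq] := uniq_min_size un' sub (eq_leq (etrans (size_iota 0 n) (esym sz))).
  by apply: uniq_perm; rewrite ?iota_uniq.
have ev : evN s5 (Read (Enc TAB (Lit 0) (Lit 0) (Lit 0))) = value E u vs 0 0 0.
  by rewrite /= (evN_Enc _ _ _ _ r15) /= ft5.
apply: wp_assign.
- by rewrite /=; apply: (fits_Enc roomy) => //=; lia.
- rewrite ev; exists S; split=> /= [v vn||S'].
  + by apply: ms; rewrite (perm_mem pe) mem_iota.
  + by rewrite -(perm_list_cut E S pe) cutS.
  + by rewrite -(perm_list_cut E S' pe) (value_max E_sym pw).
- by rewrite /= cost_Enc.
Qed.

Lemma degree_nbhd n (e : rel 'I_n) (v : 'I_n) : degree n (nat_rel e) v = #|nbhd e v|.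
Proof.
rewrite /degree big_mkord -sum1dep_card [RHS]big_mkcond; apply: eq_bigr => x _ /=.
by rewrite nat_relE; case: (e v x).
Qed.

(** The bridge between graph and program: [bicliques_next], applied to the unlisted vertices and to
    the partition determined by [u], guarantees that the search in [prog_next] succeeds. *)
Lemma next_exists n (e : rel 'I_n) u vs : symmetric e -> irreflexive e -> cobipartite_chain e ->
  (0 < n -> u < n /\ forall v, v < n -> degree n (nat_rel e) u <= degree n (nat_rel e) v) ->
  uniq vs -> (forall v, v \in vs -> v < n) -> size vs < n ->
  exists2 v, v < n & ready n (nat_rel e) u (fun v => v \in vs) v.
Proof.
move=> es ei ch umin un lt sz; have n0 : 0 < n by exact: leq_ltn_trans sz.
have [ult {}umin] := umin n0; pose U := Ordinal ult.
have bic : bicliques e [predC far e U] (far e U).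
  by apply: far_bicliques => // v; rewrite -!degree_nbhd umin.
have labE (x : 'I_n) : (x \in far e U) = label (nat_rel e) u x.
  by rewrite /label /far (nat_relE e U x).
have Rn0 : [set v : 'I_n | val v \notin vs] != set0.
  apply/negP => /eqP/setP R0; have := @uniq_leq_size _ (iota 0 n) vs (iota_uniq 0 n).
  rewrite size_iota leqNgt sz => h; apply/notF/h => x; rewrite mem_iota /= add0n => xn.
  by have := R0 (Ordinal xn); rewrite !inE /= => /negbFE.
have [v] := bicliques_next es bic Rn0.
rewrite inE => vR vnext; exists v => //; rewrite /ready vR /=; apply/allP => x.
rewrite mem_iota add0n => /andP[_ xn]; pose X := Ordinal xn.
case xvs: (x \in vs) => //=; case: (eqVneq x v) => //= xv.
have := vnext X; rewrite inE /= xvs => /(_ isT xv); rewrite !labE /precedes => <-.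
by rewrite (nat_relE e v X).
Qed.

Lemma input_graph n (e : rel 'I_n) : stores_graph n (nat_rel e) (mem (input e)).
Proof.
move=> v x vn xn /=; congr nat_of_bool; apply: eq_existsb => i; apply: eq_existsb => j.
congr (_ && _); apply/eqP/andP => [/mulnD_inj[]// -> ->|[/eqP-> /eqP->] //].
by rewrite !eqxx.
Qed.

Lemma input_blank n (e : rel 'I_n) k : 0 < k -> blank n k (mem (input e)).
Proof.
move=> k0 a b c aM bM cM /=; case: existsP => // -[i /existsP[j /andP[_ /eqP eq]]].
have := enc_ge n.+1 a b c k0; rewrite eq.
have := ltn_ord i; have := ltn_ord j; nia.
Qed.

(** With [X] the power of 2 given by the bit length of [n], both 2 and [n.+1] are at most [X]. Three
    factors [X] absorb 8 and three more absorb the cube, whence 6. *)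
Lemma word_bits_roomy n : 8 * (n.+1 * n.+1 * n.+1) <= 2 ^ word_bits 6 n.
Proof.
rewrite /word_bits (mulnC 6) expnM; set X := 2 ^ _.
have X2 : 2 <= X by rewrite -[leqLHS]expn1 leq_exp2l.
have Xn : n < X by exact: trunc_log_ltn.
rewrite (expnD X 3 3) leq_mul //; first by rewrite (leq_exp2r 2 X (e := 3)).
by rewrite !expnS expn0 muln1 -mulnA !leq_mul.
Qed.

Theorem theorem4 :
  exists (p : prog) (T : nat -> nat),
    bigO T (fun n => n ^ 4) /\
    solves_maxcut_in_time (fun n (e : rel 'I_n) => cobipartite_chain e) p T.
Proof.
exists prog_maxcut, maxcut_time; split.
  (* The coefficients of the cubic [maxcut_time] sum to less than 5000. The bound starts at 1
     because the additive constant is positive while [n ^ 4] vanishes at 0. *)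
  exists 5000, 1 => n n1; rewrite /maxcut_time !expnS expn0 muln1.
  have h2 : n <= n * n by nia.
  have h3 : n * n <= n * (n * n) by nia.
  have h4 : n * (n * n) <= n * (n * (n * n)) by nia.
  lia.
exists 6 => // n e es ei ch.
have [t [s [ex le [S [ms r0 mx]]]]] :=
  @wp_maxcut _ n (nat_rel e) (input e) (word_bits_roomy n) (nat_rel_sym es)
    (fun u umin vs un lt sz => next_exists es ei ch umin un lt sz)
    erefl (@input_graph n e) (fun k kP => input_blank e (proj1 (andP kP))).
pose SS := [set i : 'I_n | S i].
have cutE (P : pred nat) (Q : {set 'I_n}) : (forall i : 'I_n, P i = (i \in Q)) ->
  cut_size e Q = list_cut (nat_rel e) P (iota 0 n) by exact: cut_size_list_cut.
exists t, s, SS; split=> //.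
  split=> [i|]; first by rewrite ms ?inE.
  by rewrite r0 (cutE S) // => i; rewrite inE.
move=> Q; pose P x := [exists i : 'I_n, (val i == x) && (i \in Q)].
rewrite (cutE P) => [|i].
  by rewrite (cutE S) -?r0 // => i; rewrite inE.
apply/existsP/idP => [[j /andP[/eqP/val_inj-> //]]|iQ].
by exists i; rewrite eqxx.
Qed.
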